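(* There exists $C_2>0$ such that for every $n$ large enough and every $j\in\{1,\dots,\lfloor\log n\rfloor\}$, $$\lambda_{n,j}=G\left(\frac{\varphi_{r,j}}{n+2}+\frac{\psi_{r,j}}{(n+2)^2}+\frac{\tau_{r,j}}{(n+2)^3}\right)+R_{2,n,j},\qquad\text{where}\qquad |R_{2,n,j}|\le\frac{C_2\,j^3}{(n+2)^4}.$$
   Context: $a(t)=t^{-1}+t^2$, and $T_n(a)$ is the $n\times n$ Toeplitz matrix whose $(j,k)$ entry is $1$ if $k=j+1$ or $k=j-2$, and $0$ otherwise. For $n\ge3$ write $n=3m+r$ with $m\in\mathbb{N}$, $r\in\{0,1,2\}$. $L=3/\sqrt[3]{4}$. $T_n(a)$ has exactly $m$ eigenvalues in $(0,L)$, all simple, denoted $0<\lambda_{n,1}<\dots<\lambda_{n,m}<L$. $\log$ is the natural logarithm. Define $G\colon[0,1/3]\to[0,L]$ by $$G(\alpha)=\frac{L\left(1-\frac13\tan^2(\frac\pi3-\pi\alpha)\right)}{\left(1+\tan^2(\frac\pi3-\pi\alpha)\right)^{2/3}}.$$ For $r\in\{0,1,2\}$ and $j\in\mathbb{N}=\{1,2,\dots\}$ define functions $[0,+\infty)\to\mathbb{R}$ by $$\omega_{r,j,0}(\gamma)=\gamma-j+\frac12-\frac r3+\frac{(-1)^{r+j}}{\pi}\arcsin\left(\frac12 e^{-\sqrt3\,\pi\gamma}\right),$$ $$\omega_{r,j,1}(\gamma)=\frac{2(-1)^{r+j}\pi\gamma^2}{(4e^{2\sqrt3\pi\gamma}-1)^{1/2}},$$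 $$\omega_{r,j,2}(\gamma)=-\frac{2\sqrt3}{3}\pi\gamma^2+(-1)^{r+j}\left(\frac{2\left(-\pi\gamma^2-\frac{2\sqrt3}{3}\pi^2\gamma^3+\pi^3\gamma^4\right)}{(4e^{2\sqrt3\pi\gamma}-1)^{1/2}}+\frac{2\pi^3\gamma^4}{(4e^{2\sqrt3\pi\gamma}-1)^{3/2}}\right).$$ Let $\varphi_{r,j}$ be the unique $\gamma\in[0,+\infty)$ with $\omega_{r,j,0}(\gamma)=0$, and put $$\psi_{r,j}=-\frac{\omega_{r,j,1}(\varphi_{r,j})}{\omega_{r,j,0}'(\varphi_{r,j})}=\frac{2\pi\varphi_{r,j}^2}{\sqrt3+(-1)^{r+j+1}\sqrt{4e^{2\sqrt3\pi\varphi_{r,j}}-1}},$$ $$\tau_{r,j}=-\frac{1}{\omega_{r,j,0}'(\varphi_{r,j})}\left(\frac{\omega_{r,j,0}''(\varphi_{r,j})}{2}\psi_{r,j}^2+\omega_{r,j,1}'(\varphi_{r,j})\psi_{r,j}+\omega_{r,j,2}(\varphi_{r,j})\right).$$ *)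

(* Defs.v *)
From HB Require Import structures.
From mathcomp Require Import all_boot all_order all_algebra.
From mathcomp Require Import finmap.
From mathcomp Require Import all_classical all_reals all_analysis.

Set Implicit Arguments.
Unset Strict Implicit.
Unset Printing Implicit Defensive.

Import Order.TTheory GRing.Theory Num.Theory.
Import numFieldNormedType.Exports.

Local Open Scope classical_set_scope.
Local Open Scope ring_scope.

Section Definitions.
Variable R : realType.

(* The Toeplitz matrix with symbol t^-1 + t^2: entry (i, k) is the Fourier
   coefficient of index i - k, so it is 1 for k = i + 1 and for i = k + 2. *)
Definition toeplitz (n : nat) : 'M[R]_n :=
  \matrix_(i < n, k < n)
    (((k : nat) == i + 1)%N || ((i : nat) == k + 2)%N)%:R.

Definition L : R := 3 / (4 `^ 3^-1).

(* The set below is finite, so fset_set does not take its junk value. *)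
Definition eigs (n : nat) : seq R :=
  sort <=%R (fset_set [set x : R | eigenvalue (toeplitz n) x /\ 0 < x < L]).

(* The j-th smallest eigenvalue in (0, L), for j starting from 1. *)
Definition lambda (n j : nat) : R := nth 0 (eigs n) j.-1.

Definition G (alpha : R) : R :=
  L * (1 - 3^-1 * tan (pi / 3 - pi * alpha) ^+ 2)
  / ((1 + tan (pi / 3 - pi * alpha) ^+ 2) `^ (2 / 3)).

(* The formulas are used only on [0, +oo), and derivatives only at phi r j,
   which lies in ]0, +oo[, so two-sided derivatives are the right ones. *)
Definition omega0 (r j : nat) (g : R) : R :=
  g - j%:R + 2^-1 - r%:R / 3
  + (-1) ^+ (r + j) / pi * asin (2^-1 * expR (- (Num.sqrt 3 * pi * g))).

Definition omega1 (r j : nat) (g : R) : R :=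
  2 * (-1) ^+ (r + j) * pi * g ^+ 2
  / ((4 * expR (2 * Num.sqrt 3 * pi * g) - 1) `^ (1 / 2)).

Definition omega2 (r j : nat) (g : R) : R :=
  - (2 * Num.sqrt 3 / 3) * pi * g ^+ 2
  + (-1) ^+ (r + j) *
    (2 * (- (pi * g ^+ 2) - 2 * Num.sqrt 3 / 3 * pi ^+ 2 * g ^+ 3
          + pi ^+ 3 * g ^+ 4)
       / ((4 * expR (2 * Num.sqrt 3 * pi * g) - 1) `^ (1 / 2))
     + 2 * pi ^+ 3 * g ^+ 4
       / ((4 * expR (2 * Num.sqrt 3 * pi * g) - 1) `^ (3 / 2))).

(* omega0 r j has exactly one zero in [0, +oo) when j >= 1. *)
Definition phi (r j : nat) : R :=
  xget 0 [set g : R | 0 <= g /\ omega0 r j g = 0].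

Definition psi (r j : nat) : R :=
  - (omega1 r j (phi r j) / derive1 (omega0 r j) (phi r j)).

Definition tau (r j : nat) : R :=
  - (1 / derive1 (omega0 r j) (phi r j)) *
  (derive1n 2 (omega0 r j) (phi r j) / 2 * psi r j ^+ 2
   + derive1 (omega1 r j) (phi r j) * psi r j
   + omega2 r j (phi r j)).

End Definitions.

Arguments L {R}.
Arguments lambda {R}.
Arguments phi {R}.
Arguments psi {R}.
Arguments tau {R}.

(* Main.v *)
(* With [theta = pi/3 - pi alpha] and [c = 2 cos theta], the roots of
   [t^3 - lambda t^2 + 1] for [lambda = G alpha] are [rho e^(i theta)], its
   conjugate and [- rho / c], where [rho = c^(1/3)]. Solving the three-term
   recurrence of the characteristic polynomials [p_n] of the Toeplitz matrices
   turns [p_n lambda = 0], with [N = n + 2], into the secular equation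
     2 sin (N theta) + sin (n theta) + (-1)^n c^-(n + 1) sin theta = 0.
   Its left-hand side alternates in sign at [theta = (k + 1/2) pi / N],
   [k = 0 .. n/3], which produces [n/3] zeros; as [p_n] is [X^r] times a
   polynomial of degree [n/3] in [X^3], there are no others, so the [j]-th
   eigenvalue is [G] of the zero in the [j]-th interval.
   After division by an amplitude, the secular function at
   [alpha = gamma h], [h = 1 / N], is
   [sin (pi delta) - t cos (pi delta) + (+- 1/2) (1 - sqrt 3 t) c^-N] with
   [delta = gamma - j + 1/2 - r/3] and [t] of order [h^2]. Expanded at
   [gamma = phi + psi h + tau h^2 + eta], its terms of order [0], [h] and [h^2]
   vanish by the definitions of [phi], [psi] and [tau], and what remains is
   [pi (w - sqrt 3 s u) eta + O(j^3 h^3)] with a slope bounded below. Taking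
   [eta = +- K j^3 h^3] gives a change of sign, hence a zero within
   [K j^3 h^4] of [alpha], and [G] is Lipschitz. *)
Require Import Defs.
From HB Require Import structures.
From mathcomp Require Import all_boot all_order all_algebra.
From mathcomp Require Import finmap.
From mathcomp Require Import all_classical all_reals all_analysis.
From mathcomp Require Import ring lra zify.

Set Implicit Arguments.
Unset Strict Implicit.
Unset Printing Implicit Defensive.

Import Order.TTheory GRing.Theory Num.Theory.
Import numFieldNormedType.Exports.

Local Open Scope ring_scope.

(** * Characteristic polynomials *)

Section CharacteristicPolynomial.
Variable R : realType.
Implicit Types (n i : nat) (x : R).

(** These are the polynomials det(X - T_n), given by their recurrence; [eigenvalue_toeplitz] links
    their roots to eigenvectors directly. *)
Fixpoint charp n : {poly R} :=
  match n with
  | 0 => 1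
  | n'.+1 => 'X * charp n' - (if n' is n''.+2 then charp n'' else 0)
  end.

Lemma charp_coef n i : (n <= i)%N -> (charp n)`_i = (i == n)%:R.
Proof.
have [k] := ubnP n; elim: k n i => // k IHk [|n] i ltnk leni; first by rewrite coefC;
  case: i leni.
rewrite /= coefB coefXM; case: i leni => // i leni.
rewrite /= IHk// ?eqSS; case: n ltnk leni => [|[|n]] ltnk leni;
  rewrite ?coef0 ?subr0//.
have ni : (n < i.+1)%N by lia.
by rewrite IHk ?(gtn_eqF ni) ?subr0//; lia.
Qed.

Lemma charp_neq0 n : charp n != 0.
Proof.
apply/eqP => p0; have := charp_coef (leqnn n).
by rewrite p0 coef0 eqxx => /esym/eqP; rewrite oner_eq0.
Qed.

(** Both ['X * charp n.+2] and [charp n] involve only exponents congruent to n modulo 3, so the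
    recurrence preserves this shape. *)
Lemma charp_cube n : exists2 q : {poly R},
  charp n = 'X^(n %% 3) * (q \Po 'X^3) & (size q <= (n %/ 3).+1)%N.
Proof.
have [k] := ubnP n; elim: k n => // k IHk n ltnk.
case: n ltnk => [|[|[|n]]] ltnk.
- by exists 1; rewrite ?size_poly1// comp_polyC expr0 mul1r.
- by exists 1; rewrite ?size_poly1// comp_polyC /= subr0.
- by exists 1; rewrite ?size_poly1// comp_polyC /= !subr0 expr2 mulrA.
have [q2 e2 s2] := IHk n.+2 (ltac:(lia)); have [q0 e0 s0] := IHk n (ltac:(lia)).
have -> : charp n.+3 = 'X * charp n.+2 - charp n by [].
have m3 : (n.+3 %% 3 = n %% 3)%N by lia.
have d3 : (n.+3 %/ 3 = (n %/ 3).+1)%N by lia.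
rewrite e2 e0 m3 d3.
(* If 3 divides n, X times X^2 is a full cube, absorbed by the inner polynomial; otherwise X only
   raises the outer power. *)
have [n0|nN0] := eqVneq (n %% 3)%N 0%N.
  have -> : (n.+2 %% 3 = 2)%N by lia.
  exists ('X * q2 - q0).
    by rewrite comp_polyB comp_polyM comp_polyX n0 expr0 !mul1r mulrA -exprS.
  rewrite (leq_trans (size_polyD _ _))// geq_max size_polyN; apply/andP; split.
    rewrite (leq_trans (size_polyMleq _ _))// size_polyX /= ltnS.
    by rewrite (leq_trans s2)//; lia.
  by rewrite (leq_trans s0).
have -> : (n %% 3 = (n.+2 %% 3).+1)%N by lia.
exists (q2 - q0); first by rewrite comp_polyB mulrA -exprS mulrBr.
rewrite (leq_trans (size_polyD _ _))// geq_max size_polyN (leq_trans s0)// andbT.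
by rewrite (leq_trans s2)//; lia.
Qed.

(** Cubing is injective on positive reals and sends these roots to roots of the inner polynomial of
    [charp_cube], of degree at most n/3. *)
Lemma size_pos_roots n (s : seq R) : uniq s ->
  all (fun x => (0 < x) && root (charp n) x) s -> (size s <= n %/ 3)%N.
Proof.
move=> us /allP rs; have [q qE sq] := charp_cube n.
have q0 : q != 0.
  by apply: contra_neq (charp_neq0 n) => q0; rewrite qE q0 comp_poly0 mulr0.
rewrite -ltnS (leq_trans _ sq)// -(size_map (fun x => x ^+ 3)).
apply: max_poly_roots => //.
  apply/allP => _ /mapP[x /rs /andP[x0 rx] ->].
  move: rx; rewrite qE rootM /root hornerXn expf_eq0 (gt_eqF x0) andbF/=.
  by rewrite horner_comp hornerXn.
rewrite map_inj_in_uniq// => x y /rs /andP[x0 _] /rs /andP[y0 _] /eqP.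
by rewrite eqrXn2 ?(ltW x0) ?(ltW y0)// => /eqP.
Qed.

(** [eigenvalue] concerns row vectors, hence the product on this side. Extension by zero beyond n
    lets the last two columns obey the general formula. *)
Lemma toeplitz_mul n (f : nat -> R) (k : 'I_n) : (forall i, (n <= i)%N -> f i = 0) ->
  ((\row_(i < n) f i) *m toeplitz R n) 0 k = (if (k : nat) is k'.+1 then f k' else 0)
    + f k.+2.
Proof.
move=> f0; rewrite mxE.
have -> : \sum_j (\row_i f i) 0 j * toeplitz R n j k =
  \sum_(j < n | (j.+1 == k)%N) f j + \sum_(j < n | (j == k.+2 :> nat)%N) f j.
  rewrite [X in _ = X + _]big_mkcond [X in _ = _ + X]big_mkcond -big_split/=.
  apply: eq_bigr => j _; rewrite !mxE addn1 addn2 (eq_sym j.+1).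
  have [->|] := eqVneq (k : nat) j.+1.
    have -> : ((j : nat) == j.+3) = false by apply/eqP; lia.
    by rewrite addr0 mulr1.
  by move=> _ /=; rewrite add0r; case: eqP => _; rewrite ?mulr1 ?mulr0.
congr (_ + _).
  case: k => -[|k] kn /=; first by rewrite big_pred0.
  by rewrite (big_pred1 (Ordinal (ltnW kn)))// => i; rewrite eqSS.
have [lt|ge] := ltnP k.+2 n; first by rewrite (big_pred1 (Ordinal lt)).
by rewrite f0// big_pred0// => i; apply/eqP; have := ltn_ord i; lia.
Qed.

Lemma charp_horner n x : (charp n.+1).[x] =
  x * (charp n).[x] - (if n is n''.+2 then (charp n'').[x] else 0).
Proof. by rewrite /= hornerD hornerN hornerM hornerX; case: n => [|[|n]];
  rewrite ?horner0. Qed.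

(* Rows of the eigenvector equation, read from the last one up, are the
   recurrence of [charp]; its boundary condition is [charp n] vanishing. *)
Lemma eigenvalue_toeplitz n x : eigenvalue (toeplitz R n) x = root (charp n) x.
Proof.
apply/eigenvalueP/idP => [[v vT v0]|rt].
  pose f i := oapp (v 0) 0 (insub i : option 'I_n).
  have vE : v = \row_i f i by apply/rowP => i; rewrite mxE /f valK.
  have f0 i : (n <= i)%N -> f i = 0 by move=> ni; rewrite /f insubF// ltnNge ni.
  have rec k : (k < n)%N -> (if k is k'.+1 then f k' else 0) + f k.+2 = x * f k.
    move=> kn; have := congr1 (fun w : 'rV_n => w 0 (Ordinal kn)) vT.
    by rewrite {1}vE toeplitz_mul// => -> ; rewrite vE !mxE.
  have fE i : (i < n)%N -> f (n - i.+1)%N = f n.-1 * (charp i).[x].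
    have [k] := ubnP i; elim: k i => // k IHk [|i] ltik lein.
      by rewrite hornerC mulr1 subn1.
    have := rec (n - i.+1)%N (ltac:(lia)).
    have ni : (n - i.+1 = (n - i.+2).+1)%N by lia.
    rewrite charp_horner mulrBr mulrCA -IHk//; [|lia].
    rewrite ni => <-; rewrite -addrA -[LHS]addr0; congr (_ + _); apply/esym/eqP.
    rewrite subr_eq0; apply/eqP; case: i ltik lein {ni} => [|[|i]] ltik lein.
    - by rewrite f0 ?mulr0//; lia.
    - by rewrite f0 ?mulr0//; lia.
    - by rewrite -IHk; [congr f; lia|lia|lia].
  case: n v f vE f0 rec fE vT v0 => [|n] v f vE f0 rec fE vT v0.
    by case/eqP: v0; apply/rowP => -[].
  (* By [fE], a vanishing last entry would make the whole vector vanish. *)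
  have fn0 : f n != 0.
    apply: contra_neq v0 => fn0; rewrite vE; apply/rowP => i; rewrite !mxE.
    have := fE (n - i)%N (ltac:(lia)).
    by rewrite (_ : (n.+1 - (n - i).+1)%N = i) ?fn0 ?mul0r//; have := ltn_ord i; lia.
  rewrite /root -(mulrI_eq0 _ (mulfI fn0)) charp_horner mulrBr mulrCA.
  have /= := fE n (ltnSn n); rewrite subnn => <-; rewrite -rec//=.
  case: n v f vE f0 rec fE vT v0 fn0 => [|[|n]] v f vE f0 rec fE vT v0 fn0.
  - by rewrite f0// mulr0 addr0 subr0.
  - by rewrite f0// mulr0 addr0 subr0.
  - have := fE n (ltac:(lia)); rewrite (_ : (n.+3 - n.+1 = 2)%N) /=; last by lia.
    by move=> ->; rewrite add0r subrr.
case: n rt => [|n] rt; first by move: rt; rewrite /root hornerC oner_eq0.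
pose f i := if (i < n.+1)%N then (charp (n - i)).[x] else 0.
have f0 i : (n.+1 <= i)%N -> f i = 0 by move=> ni; rewrite /f ltnNge ni.
exists (\row_i f i); last first.
  apply/eqP => /rowP /(_ ord_max); rewrite !mxE /f /= ltnSn subnn hornerC.
  by move/eqP; rewrite oner_eq0.
apply/rowP => k; rewrite toeplitz_mul// !mxE.
have kn := ltn_ord k.
have fk : f k = (charp (n - k)).[x] by rewrite /f kn.
have recE : (charp (n - k).+1).[x] = x * f k - f k.+2.
  rewrite charp_horner fk; congr (_ - _); rewrite /f.
  case: (ltnP k.+2 n.+1) => lt; last by case: (n - k)%N (ltac:(lia) : (n -
    k <= 1)%N) => [|[|]].
  by rewrite (_ : (n - k = (n - k.+2).+2)%N)//; lia.
have -> : x * f k = (charp (n - k).+1).[x] + f k.+2 by rewrite recE subrK.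
congr (_ + _); case: (k : nat) kn => [|k'] kn /=.
  by rewrite subn0 (eqP rt).
by rewrite /f ltnW// (_ : (n - k' = (n - k'.+1).+1)%N)//; lia.
Qed.

(** By [size_pos_roots], n/3 eigenvalues in (0, L) leave no room for another one, so the sorted list
    of eigenvalues is exactly the list of the [y k]. *)
Lemma lambda_eq n (y : nat -> R) :
  (forall k, (1 <= k <= n %/ 3)%N -> root (charp n) (y k) /\ 0 < y k < L) ->
  (forall k, (1 <= k < n %/ 3)%N -> y k < y k.+1) ->
  forall j, (1 <= j <= n %/ 3)%N -> lambda n j = y j.
Proof.
move=> yr ylt j jn; set m := (n %/ 3)%N in yr ylt jn *.
pose s := map y (iota 1 m).
have s_sorted : sorted <%R s.
  apply/(sortedP 0) => i; rewrite size_map size_iota => im.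
  rewrite !(nth_map 0%N) ?size_iota// 1?ltnW// !nth_iota// 1?ltnW//.
  by rewrite addnS; apply: ylt; lia.
have s_uniq : uniq s := lt_sorted_uniq s_sorted.
pose A : set R := [set x : R | eigenvalue (toeplitz R n) x /\ 0 < x < L]%classic.
have sA x : x \in s -> A x.
  move=> /mapP[k]; rewrite mem_iota => kin ->.
  by have [ry yL] := yr k (ltac:(lia)); split => //; rewrite eigenvalue_toeplitz.
have As x : A x -> x \in s.
  rewrite /A /= eigenvalue_toeplitz => -[rx /andP[x0 xL]].
  apply: contraT => xs; have := @size_pos_roots n (x :: s).
  rewrite /= xs s_uniq x0 rx/= size_map size_iota -/m ltnn; apply=> //.
  by apply/allP => z /sA [+ /andP[-> _]]; rewrite eigenvalue_toeplitz.
have AE : A = [set` s]%classic.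
  by apply/seteqP; split => x /= => [/As|/sA].
rewrite /lambda /eigs -/A.
have -> : sort <=%R (fset_set A) = s.
  apply: (@sorted_eq _ <=%R) => //; [exact: le_trans|exact: le_anti|..].
  - exact/sort_sorted/le_total.
  - by apply: sub_sorted s_sorted => a b; exact: ltW.
  rewrite perm_sort; apply: uniq_perm => [||x]; [exact: fset_uniq|by []|].
  by rewrite AE in_fset_set ?mem_setE//; exact: finite_seq.
rewrite (nth_map 0%N) ?size_iota ?nth_iota; try lia.
by congr y; lia.
Qed.

End CharacteristicPolynomial.

(** * The secular equation and the localization of its zeros *)

Section Trigonometry.
Variable R : realType.
Implicit Types (x y t a b theta alpha : R) (n m k : nat).

Local Notation s3 := (Num.sqrt 3 : R).

Lemma sign_cases k : (-1) ^+ k = 1 :> R \/ (-1) ^+ k = -1 :> R.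
Proof. by rewrite -signr_odd; case: odd; [right|left]; rewrite ?expr1 ?expr0. Qed.

Lemma sqr_s3 : s3 ^+ 2 = 3.
Proof. by rewrite sqr_sqrtr. Qed.

Lemma s3_bound : 17 / 10 <= s3 <= 2.
Proof.
have h0 : 0 <= s3 by exact: sqrtr_ge0.
by have e := sqr_s3; apply/andP; split; nra.
Qed.

Lemma sinBpi x : sin (pi - x) = sin x.
Proof. by rewrite sinB sinpi cospi mul0r mulN1r sub0r opprK. Qed.

Lemma cos_pi3 : cos (pi / 3 : R) = 2^-1.
Proof.
have pi0 : 0 < pi :> R by exact: pi_gt0.
have s0 : 0 < sin (pi / 3 : R) by apply: sin_gt0_pi; apply/andP; split; lra.
have : sin (pi / 3 : R) = cos (pi / 3) * sin (pi / 3) *+ 2.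
  by rewrite -sin_mulr2n -[LHS]sinBpi; congr sin; field.
move=> e; apply: (mulIf (lt0r_neq0 s0)).
by lra.
Qed.

Lemma sin_pi3 : sin (pi / 3 : R) = s3 / 2.
Proof.
have pi0 : 0 < pi :> R by exact: pi_gt0.
have s0 : 0 < sin (pi / 3 : R) by apply: sin_gt0_pi; apply/andP; split; lra.
apply/eqP; rewrite -(@eqrXn2 _ 2)// ?(ltW s0) ?divr_ge0 ?sqrtr_ge0//.
by rewrite sin2cos2 cos_pi3 expr_div_n sqr_s3; apply/eqP; field.
Qed.

Lemma sin_addnS n theta : sin (n.+2%:R * theta) =
  2 * cos theta * sin (n.+1%:R * theta) - sin (n%:R * theta).
Proof.
have -> : n.+2%:R * theta = n.+1%:R * theta + theta by rewrite -[in LHS]natr1; ring.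
have -> : n%:R * theta = n.+1%:R * theta - theta by rewrite -[in RHS]natr1; ring.
by rewrite sinD sinB; ring.
Qed.

(** The secular equation multiplied by c^(n + 1), c = 2 cos theta, so that a linear recurrence in n
    holds. *)
Definition secular n theta : R :=
  (2 * cos theta) ^+ n.+1 * (2 * sin (n.+2%:R * theta) + sin (n%:R * theta))
  + (-1) ^+ n * sin theta.

(** The characteristic polynomial X^3 - (c^2 - 1) X^2 + c^2 factors as (X + 1) (X^2 - c^2 X + c^2);
    its roots -1 and c e^(+-i theta) are those whose powers make up [secular]. *)
Lemma secular_rec n theta : secular n.+3 theta =
  ((2 * cos theta) ^+ 2 - 1) * secular n.+2 theta -
    (2 * cos theta) ^+ 2 * secular n theta.
Proof. by rewrite /secular !(sin_addnS n.+3) !(sin_addnS n.+2) !(sin_addnS n.+1)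
  !(sin_addnS n) !exprS; ring. Qed.

(** Scaled by (c / rho)^n, with rho^3 = c, the recurrence of [charp] becomes [secular_rec], so it
    suffices to compare the two sides for n = 0, 1, 2. *)
Lemma charp_secular n theta (rho : R) :
  let c := 2 * cos theta in 0 < c -> rho ^+ 3 = c ->
  (charp R n).[rho * (c - c^-1)] * (sin theta * (2 * c ^+ 2 + 1)) * c ^+ n =
  rho ^+ n * secular n theta.
Proof.
move=> c c0 rhoE; have cN0 := lt0r_neq0 c0.
have S2 : sin (2 * theta) = c * sin theta.
  by rewrite (sin_addnS 0) mul1r mul0r sin0 subr0.
have S3 : sin (3 * theta) = c * sin (2 * theta) - sin theta.
  by rewrite (sin_addnS 1) mul1r.
have S4 : sin (4 * theta) = c * sin (3 * theta) -
  sin (2 * theta) by exact: (sin_addnS 2).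
have [k] := ubnP n; elim: k n => // k IHk [|[|[|n]]] ltnk.
- by rewrite hornerC /secular S2 mul0r sin0 /c; ring.
- rewrite charp_horner hornerC /secular S3 S2 mul1r -/c.
  by field.
- rewrite !charp_horner hornerC /secular S4 S3 S2 -/c.
  by field.
have -> : (charp R n.+3).[rho * (c - c^-1)] = rho * (c - c^-1) *
    (charp R n.+2).[rho * (c - c^-1)] - (charp R n).[rho * (c - c^-1)].
  by rewrite charp_horner.
have e2 := IHk n.+2 (ltac:(lia)); have e0 := IHk n (ltac:(lia)).
rewrite secular_rec -/c.
set P2 := (charp R n.+2).[_] in e2 *; set P0 := (charp R n).[_] in e0 *.
set K := sin theta * _ in e2 e0 *.
have -> : (rho * (c - c^-1) * P2 - P0) * K * c ^+ n.+3 =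
  rho * (c ^+ 2 - 1) * (P2 * K * c ^+ n.+2) - c ^+ 3 * (P0 * K * c ^+ n).
  by rewrite !exprS; field.
have -> : c ^+ 3 = rho ^+ 3 * c ^+ 2 by rewrite rhoE exprS.
by rewrite e2 e0 !exprS; ring.
Qed.

(** * The parametrization G of the interval (0, L) *)

Definition rho alpha : R := (2 * cos (pi / 3 - pi * alpha)) `^ 3^-1.

Section OnInterval.
Variable alpha : R.
Hypothesis alpha_itv : 0 <= alpha <= 1 / 3.
Let c := 2 * cos (pi / 3 - pi * alpha).

Lemma theta_itv : 0 <= pi / 3 - pi * alpha <= pi / 3.
Proof. by move: alpha_itv (@pi_gt0 R) => /andP[? ?] ?; apply/andP; split; nra. Qed.

Lemma cos_theta_itv : 1 <= c <= 2.
Proof.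
have pi0 := @pi_gt0 R; have /andP[t0 t3] := theta_itv.
apply/andP; split; last by rewrite /c; have := cos_le1 (pi / 3 - pi * alpha); lra.
have -> : 1 = 2 * cos (pi / 3) :> R by rewrite cos_pi3; field.
rewrite /c ler_pM2l//; have [->//|lt] := eqVneq (pi / 3 - pi * alpha) (pi / 3).
apply/ltW; rewrite ltr_cos ?in_itv/= ?t0//=; [by rewrite lt_neqAle lt|lra|].
by apply/andP; split; lra.
Qed.

Lemma rho_cube : rho alpha ^+ 3 = c.
Proof.
have /andP[c1 _] := cos_theta_itv.
rewrite -powR_mulrn ?powR_ge0// -powRrM mulVf ?powRr1//.
by rewrite -/c; lra.
Qed.

Lemma rho_itv : 1 <= rho alpha <= 2.
Proof.
have r0 : 0 <= rho alpha by exact: powR_ge0.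
have := rho_cube; have /andP[] := cos_theta_itv; set r := rho alpha in r0 *.
by move=> c1 c2 e; apply/andP; split; [rewrite leNgt; apply/negP => lt; nra|nra].
Qed.

(** The right-hand side is the sum of the three roots of t^3 - lambda t^2 + 1, hence lambda. *)
Lemma G_rho : G alpha = rho alpha * (c - c^-1).
Proof.
have /andP[c1 c2] := cos_theta_itv; have /andP[r1 r2] := rho_itv.
have rE := rho_cube; set r := rho alpha in r1 r2 rE *.
have cN0 : c != 0 by lra.
have cosE : cos (pi / 3 - pi * alpha) = c / 2 by rewrite /c; field.
have cosN0 : cos (pi / 3 - pi * alpha) != 0 by rewrite cosE; lra.
have tE : tan (pi / 3 - pi * alpha) ^+ 2 = 4 / c ^+ 2 - 1.
  have := cos2_tan2 cosN0; rewrite cosE => e.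
  have -> : 4 / c ^+ 2 = (c / 2) ^- 2 by field.
  by rewrite e; ring.
rewrite /G /L tE; have -> : 1 + (4 / c ^+ 2 - 1) = 4 / c ^+ 2 by ring.
pose z : R := 4 `^ 3^-1.
have z0 : 0 < z by apply: powR_gt0.
have z3 : z ^+ 3 = 4 by rewrite -powR_mulrn ?powR_ge0// -powRrM mulVf ?powRr1.
(* As c = rho^3 and 4 = z^3, the base is the cube of z / rho^2, so the real power becomes a
   square. *)
have -> : (4 / c ^+ 2) `^ (2 / 3) = (z / r ^+ 2) ^+ 2.
  have -> : 4 / c ^+ 2 = (z / r ^+ 2) ^+ 3.
    by rewrite -rE -z3; field; lra.
  have w0 : 0 <= z / r ^+ 2 by rewrite divr_ge0 ?exprn_ge0 ?(ltW z0)//; lra.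
  by rewrite -(powR_mulrn 3 w0) -powRrM -(powR_mulrn 2 w0); congr (_ `^ _); field.
rewrite -/z; have zN0 : z != 0 by lra.
have rN0 : r != 0 by lra.
have -> : (z / r ^+ 2) ^+ 2 = 4 / z / r ^+ 4 by rewrite -z3; field; lra.
by rewrite -rE; field; rewrite ?expf_neq0 ?zN0 ?rN0.
Qed.

(** With [rho] as the only variable, a difference of values of [G] factors through the difference of
    the [rho]; this gives both the Lipschitz bound and monotonicity. *)
Lemma G_rho4 : G alpha = rho alpha ^+ 4 - rho alpha ^- 2.
Proof. by rewrite G_rho -rho_cube; have /andP[r1 r2] := rho_itv; field; lra. Qed.

End OnInterval.

Lemma cos_lip x y : `|cos x - cos y| <= `|x - y|.
Proof.
wlog xy : x y / x <= y.
  by move=> H; have /orP[/H//|/H] := le_total x y; rewrite distrC (distrC x).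
have dcos t : is_derive t 1 (@cos R) (- sin t) by exact: is_derive_cos.
have [//|z _ e] := @MVT_segment R cos (fun t => - sin t) x y xy.
  by apply: continuous_subspaceT => t; exact: continuous_cos.
rewrite distrC e normrM normrN (distrC x).
by rewrite -[leRHS]mul1r ler_wpM2r// sin_max.
Qed.

Lemma G_lip a b : 0 <= a <= 1 / 3 -> 0 <= b <= 1 / 3 ->
  `|G a - G b| <= 288 * `|a - b|.
Proof.
move=> ai bi; rewrite !G_rho4//.
have /andP[ra1 ra2] := rho_itv ai; have /andP[rb1 rb2] := rho_itv bi.
have cE : rho a ^+ 3 - rho b ^+ 3 =
    2 * (cos (pi / 3 - pi * a) - cos (pi / 3 - pi * b)).
  by rewrite !rho_cube//; ring.
have cl := cos_lip (pi / 3 - pi * a) (pi / 3 - pi * b).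
set p := rho a in ra1 ra2 cE *; set q := rho b in rb1 rb2 cE *.
(* As pi < 4, rho^3 changes by at most 8 |a - b|; dividing by p^2 + p q + q^2 >= 1 passes to rho. *)
have pq : `|p - q| <= 8 * `|a - b|.
  have : `|p ^+ 3 - q ^+ 3| <= 8 * `|a - b|.
    rewrite cE normrM ger0_norm// (_ : 8 = 2 * 4); last by ring.
    rewrite -mulrA ler_pM2l// (le_trans cl)//.
    have -> : pi / 3 - pi * a - (pi / 3 - pi * b) = - (pi * (a - b)) by ring.
    rewrite normrN normrM ler_wpM2r// ger0_norm ?pi_ge0//.
    by have := @pihalf_lt2 R; lra.
  apply: le_trans; have -> : p ^+ 3 - q ^+ 3 = (p -
    q) * (p ^+ 2 + p * q + q ^+ 2) by ring.
  by rewrite normrM ler_peMr// ger0_norm; nra.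
have -> : p ^+ 4 - p ^- 2 - (q ^+ 4 - q ^- 2) =
    (p - q) * ((p + q) * (p ^+ 2 + q ^+ 2) + (p + q) * (p ^- 1 * q ^- 1) ^+ 2).
  by field; lra.
rewrite normrM.
have p1 : 0 <= p^-1 <= 1 by rewrite invr_ge0 invf_le1; lra.
have q1 : 0 <= q^-1 <= 1 by rewrite invr_ge0 invf_le1; lra.
have pq1 : 0 <= p^-1 * q^-1 <= 1 by move: p1 q1 => /andP[? ?] /andP[? ?]; apply/andP;
  split; nra.
have pq2 : 0 <= (p^-1 * q^-1) ^+ 2 <= 1 by move: pq1 => /andP[? ?]; apply/andP;
  split; nra.
(* With p and q in [1, 2] the cofactor is at most 32 + 4 = 36. *)
rewrite (_ : 288 * `|a - b| = (8 * `|a - b|) * 36); last by ring.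
apply: ler_pM => //; set w := (p^-1 * q^-1) ^+ 2 in pq2 *.
have e1 : 0 <= (p + q) * (p ^+ 2 + q ^+ 2) <= 32 by apply/andP; split; nra.
have e2 : 0 <= (p + q) * w <= 4 by move: pq2 => /andP[? ?]; apply/andP; split; nra.
by rewrite ger0_norm; lra.
Qed.

Lemma G_incr a b : 0 <= a -> a < b -> b <= 1 / 3 -> G a < G b.
Proof.
move=> a0 ab b3; have ai : 0 <= a <= 1 / 3 by lra.
have bi : 0 <= b <= 1 / 3 by lra.
have /andP[ra1 ra2] := rho_itv ai; have /andP[rb1 rb2] := rho_itv bi.
have rab : rho a < rho b.
  have pi0 := @pi_gt0 R.
  have /andP[ta0 ta] := theta_itv ai; have /andP[tb0 tb] := theta_itv bi.
  have : rho a ^+ 3 < rho b ^+ 3.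
    rewrite !rho_cube// ltr_pM2l// ltr_cos ?in_itv/=; last 2 first.
    - by apply/andP; split; lra.
    - by apply/andP; split; lra.
    by rewrite ltrD2l ltrN2 ltr_pM2l.
  move=> h; rewrite ltNge; apply/negP => le.
  by have := h; rewrite ltNge lerXn2r ?nnegrE//; lra.
rewrite !G_rho4// -subr_gt0; set p := rho a in ra1 ra2 rab *;
  set q := rho b in rb1 rb2 rab *.
have -> : q ^+ 4 - q ^- 2 - (p ^+ 4 - p ^- 2) =
    (q - p) * ((p + q) * (p ^+ 2 + q ^+ 2) + (p + q) * (p ^- 1 * q ^- 1) ^+ 2).
  by field; lra.
apply: mulr_gt0; first by rewrite subr_gt0.
by apply: ltr_pwDl; [nra|rewrite mulr_ge0 ?sqr_ge0//; lra].
Qed.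

Lemma G0 : G 0 = 0 :> R.
Proof.
have i0 : 0 <= (0 : R) <= 1 / 3 by lra.
have := rho_cube i0; rewrite mulr0 subr0 cos_pi3 divff// => r3.
by rewrite G_rho// mulr0 subr0 cos_pi3 divff// invr1 subrr mulr0.
Qed.

Lemma G13 : G (1 / 3) = L :> R.
Proof.
rewrite /G mul1r subrr tan0 expr0n/= mulr0 subr0 addr0 mulr1 powR1 divr1//.
Qed.

Lemma G_bound a : 0 < a < 1 / 3 -> 0 < G a < L.
Proof.
move=> /andP[a0 a3]; rewrite -{1}G0 -G13.
by rewrite !G_incr//; lra.
Qed.

(** * One zero of the secular function in each bracket *)

Definition secular_alpha n alpha : R := secular n (pi / 3 - pi * alpha).

Lemma continuous_secular_alpha n : continuous (secular_alpha n).
Proof.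
have cc : continuous (fun a : R => pi / 3 - pi * a).
  move=> x; apply: cvgB; first exact: cvg_cst.
  by apply: cvgM; [exact: cvg_cst|exact: cvg_id].
have cs k : continuous (fun a : R => sin (k%:R * (pi / 3 - pi * a))).
  move=> x; apply: (@continuous_comp _ _ _ (fun a => k%:R * (pi / 3 - pi * a)) sin);
    last exact: continuous_sin.
  by apply: cvgM; [exact: cvg_cst|exact: cc].
move=> x; apply: cvgD; apply: cvgM.
- have cw : continuous (fun a : R => 2 * cos (pi / 3 - pi * a)).
    move=> y; apply: cvgM; first exact: cvg_cst.
    by apply: (@continuous_comp _ _ _ (fun a => pi / 3 - pi * a) cos);
      [exact: cc|exact: continuous_cos].
  exact: (@continuous_comp _ _ _ _ (fun y =>
    y ^+ n.+1) x (cw x) (@exprn_continuous _ _ _)).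
- by apply: cvgD; [apply: cvgM; [exact: cvg_cst|exact: cs]|exact: cs].
- exact: cvg_cst.
- by apply: (@continuous_comp _ _ _ (fun a => pi / 3 - pi * a) sin);
  [exact: cc|exact: continuous_sin].
Qed.

Lemma IVT0 (f : R -> R) a b : continuous f -> a <= b -> f a * f b <= 0 ->
  exists2 c, a <= c <= b & f c = 0.
Proof.
move=> cf ab fab; have cw : {within `[a, b],
  continuous f}%classic by exact: continuous_subspaceT.
have [|c ci fc0] := IVT ab cw (v := 0); last first.
  by exists c => //; move: ci; rewrite in_itv.
rewrite ge_min le_max.
by have [fa|fa] := leP (f a) 0; have [fb|fb] := leP (f b) 0;
  have [->|] := eqVneq (f a) 0 => //; nra.
Qed.

(** Strictly inside the interval sin theta > 0, so every factor in [charp_secular] other than the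
    value of [charp n] can be cancelled. *)
Lemma charp_root n alpha : 0 < alpha < 1 / 3 -> secular_alpha n alpha = 0 ->
  root (charp R n) (G alpha).
Proof.
move=> /andP[a0 a3] s0; have ai : 0 <= alpha <= 1 / 3 by lra.
have /andP[c1 c2] := cos_theta_itv ai; have pi0 := @pi_gt0 R.
have := @charp_secular n _ _ (lt_le_trans ltr01 c1) (rho_cube ai).
rewrite -/(secular_alpha n alpha) s0 mulr0 -G_rho//.
have st : 0 < sin (pi / 3 - pi * alpha) by apply: sin_gt0_pi; apply/andP; split; nra.
move/eqP; rewrite !mulf_eq0 expf_eq0 => /orP[/orP[//|/orP[]]|/andP[_]] /eqP;
  last by lra.
  by lra.
by nra.
Qed.

(** Points at which (n + 2) theta is an odd multiple of pi / 2, numbered by increasing alpha, hence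
    by decreasing theta. *)
Definition bracket n k : R := (k%:R + (n %% 3)%:R / 3 + 1 / 6) / n.+2%:R.

Lemma bracket_theta n k : (k <= n %/ 3)%N ->
  pi / 3 - pi * bracket n k = ((n %/ 3 - k)%:R + 1 / 2) * pi / n.+2%:R.
Proof.
move=> kn; rewrite /bracket natrB//.
have nE : n.+2%:R = (n %/ 3)%:R * 3 + (n %% 3)%:R + 2 :> R.
  by rewrite -[in LHS]addn2 [in LHS](divn_eq n 3) !natrD natrM.
have n0 : n.+2%:R != 0 :> R by rewrite pnatr_eq0.
by rewrite nE in n0 *; field.
Qed.

Lemma bracket_itv n k : (k <= n %/ 3)%N -> 0 < bracket n k < 1 / 3.
Proof.
move=> kn; have pi0 := @pi_gt0 R; apply/andP; split.
  by rewrite divr_gt0// ltr_wpDl// addr_ge0// divr_ge0.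
have : 0 < pi / 3 - pi * bracket n k.
  by rewrite bracket_theta// divr_gt0// mulr_gt0// ltr_wpDl.
by nra.
Qed.

Lemma bracket_incr n k l : (k < l)%N -> bracket n k < bracket n l.
Proof. by move=> kl; rewrite ltr_pM2r ?invr_gt0// !ltrD2r ltr_nat. Qed.

(* At these points [sin ((n + 2) theta)] is [+1] or [-1] and outweighs the rest. *)
Lemma secular_bracket n k : (k <= n %/ 3)%N ->
  0 < (-1) ^+ (n %/ 3 - k) * secular_alpha n (bracket n k).
Proof.
move=> kn; have /andP[b0 b3] := bracket_itv kn; have pi0 := @pi_gt0 R.
have bi : 0 <= bracket n k <= 1 / 3 by lra.
have /andP[c1 c2] := cos_theta_itv bi; rewrite /secular_alpha.
have tE := bracket_theta kn; set t := _ - _ in c1 c2 tE *.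
set l := (n %/ 3 - k)%N in tE *; rewrite /secular.
have -> : sin (n.+2%:R * t) = (-1) ^+ l.
  have -> : n.+2%:R * t = pi / 2 + pi *+ l.
    have nN0 : n.+2%:R != 0 :> R by rewrite pnatr_eq0.
    rewrite tE -[pi *+ l]mulr_natr; move: n.+2%:R nN0 => w wN0; by field.
  by rewrite (alternatingn (@sinDpi R)) sin_pihalf mulr1.
have t0 : 0 < t < pi / 3 by rewrite /t; apply/andP; split; nra.
have s1 : sin t < 1.
  have -> : 1 = sin (pi / 2) :> R by rewrite sin_pihalf.
  by rewrite ltr_sin ?in_itv/=; lra.
have s0 : 0 < sin t by apply: sin_gt0_pi; lra.
have x1 : 1 <= (2 * cos t) ^+ n.+1 by exact: exprn_ege1.
set X := (2 * cos t) ^+ n.+1 in x1 *.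
have := sin_max (n%:R * t); set sn := sin (n%:R * t);
  rewrite ler_norml => /andP[sn1 sn2].
have [->|->] := sign_cases l; have [->|->] := sign_cases n; nra.
Qed.

Lemma bracket_root n k : (0 < k <= n %/ 3)%N ->
  exists2 a, bracket n k.-1 < a < bracket n k & secular_alpha n a = 0.
Proof.
move=> /andP[k0 kn]; have k1n : (k.-1 <= n %/ 3)%N by lia.
have h1 := secular_bracket kn; have h2 := secular_bracket k1n.
have lt : bracket n k.-1 < bracket n k by apply: bracket_incr; lia.
have e : (n %/ 3 - k.-1 = (n %/ 3 - k).+1)%N by lia.
have [|a /andP[a1 a2] sa] := IVT0 (@continuous_secular_alpha n) (ltW lt).
  move: h1 h2; rewrite e exprS; set l := (n %/ 3 - k)%N.
  by have [->|->] := sign_cases l; nra.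
exists a => //; apply/andP; split; rewrite lt_neqAle ?a1 ?a2 andbT.
  by apply: contraTneq h2 => ->; rewrite sa mulr0 ltxx.
by apply: contraTneq h1 => <-; rewrite sa mulr0 ltxx.
Qed.

(** One zero is chosen in each bracket, the given [alpha] in the j-th. The brackets are consecutive
    and [G] increases, so the images form an increasing sequence of n/3 eigenvalues. *)
Lemma lambda_root n j alpha : (0 < j <= n %/ 3)%N ->
  bracket n j.-1 < alpha < bracket n j -> secular_alpha n alpha = 0 ->
  lambda n j = G alpha.
Proof.
move=> jn al sal.
have H k : exists a, (0 < k <= n %/ 3)%N ->
    [/\ bracket n k.-1 < a < bracket n k,
      secular_alpha n a = 0 & (k = j -> a = alpha)].
  have [->|kj] := eqVneq k j; first by exists alpha.
  have [kn|kn] := boolP (0 < k <= n %/ 3)%N; last by exists 0.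
  by have [a aB aS] := bracket_root kn; exists a => _; split=> // /eqP;
    rewrite (negbTE kj).
have [y yP] := boolp.choice H.
have [_ _ /(_ erefl) <-] := yP _ jn.
apply: (@lambda_eq R n (@G R \o y)) => // k kn /=; last first.
  have [/andP[y1 y2] _ _] := yP k (ltac:(lia)).
  have [/andP[y3 y4] _ _] := yP k.+1 (ltac:(lia)).
  have /andP[b1 _] := @bracket_itv n k.-1 (ltac:(lia)).
  have /andP[_ b2] := @bracket_itv n k.+1 (ltac:(lia)).
  by apply: G_incr; [lra| exact: lt_trans y3|lra].
have [/andP[y1 y2] sy _] := yP k (ltac:(lia)).
have /andP[b1 _] := @bracket_itv n k.-1 (ltac:(lia)).
have /andP[_ b2] := @bracket_itv n k (ltac:(lia)).
have yi : 0 < y k < 1 / 3 by lra.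
by split; [exact: charp_root|exact: G_bound].
Qed.

End Trigonometry.

(** * Derivatives and Taylor bounds *)

Section Derivation.
Variable R : realType.
Implicit Types (f g : R -> R) (x a b : R).

(** These rules are stated for explicit abstractions so that [derive_step] can choose among them by
    the shape of the expression. *)
Lemma is_derive_fun_add f g x a b : is_derive x 1 f a -> is_derive x 1 g b ->
  is_derive x 1 (fun y => f y + g y) (a + b).
Proof. by move=> ? ?; exact: is_deriveD. Qed.

Lemma is_derive_fun_opp f x a : is_derive x 1 f a -> is_derive x 1 (fun y =>
  - f y) (- a).
Proof. by move=> ?; exact: is_deriveN. Qed.

Lemma is_derive_fun_mul f g x a b : is_derive x 1 f a -> is_derive x 1 g b ->
  is_derive x 1 (fun y => f y * g y) (a * g x + f x * b).
Proof.
move=> df dg; have H := is_deriveM df dg; apply: (is_derive_eq H).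
by rewrite /GRing.scale/= addrC mulrC.
Qed.

Lemma is_derive_fun_exp f n x a : is_derive x 1 f a ->
  is_derive x 1 (fun y => f y ^+ n) (n%:R * f x ^+ n.-1 * a).
Proof.
move=> df; have -> : (fun y => f y ^+ n) = f ^+ n by apply/funext => y;
  rewrite exprfctE.
exact: is_deriveX.
Qed.

Lemma is_derive_fun_inv f x a : f x != 0 -> is_derive x 1 f a ->
  is_derive x 1 (fun y => (f y)^-1) (- a / f x ^+ 2).
Proof.
move=> fx df; apply: (is_derive_eq (is_deriveV fx df)).
by rewrite /GRing.scale/= mulNr mulNr mulrC.
Qed.

Lemma is_derive_fun_comp (F : R -> R) f x a b : is_derive (f x) 1 F a -> is_derive x
  1 f b ->
  is_derive x 1 (fun y => F (f y)) (a * b).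
Proof. by move=> ? ?; exact: (@is_derive1_comp _ F f). Qed.

Lemma is_derive_to f x a b : is_derive x 1 f a -> a = b -> is_derive x 1 f b.
Proof. by move=> H <-. Qed.

Lemma is_derive_fun_cst (c : R) x : is_derive x 1 (fun=> c) 0.
Proof. exact: is_derive_cst. Qed.

Lemma is_derive_fun_id x : is_derive x 1 (fun y : R => y) 1.
Proof. exact: is_derive_id. Qed.

End Derivation.

Ltac derive_step :=
  first [ apply: is_derive_fun_cst | apply: is_derive_fun_id
        | apply: is_derive_fun_add | apply: is_derive_fun_opp
        | apply: is_derive_fun_mul | apply: is_derive_fun_exp
        | apply: is_derive_fun_inv
        | apply: is_derive_sin | apply: is_derive_cos | apply: is_derive_expR
        | apply: (is_derive_fun_comp (F := @sin _))
        | apply: (is_derive_fun_comp (F := @cos _))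
        | apply: (is_derive_fun_comp (F := @expR _)) ].

Section Taylor.
Variable R : realType.
Implicit Types (f df : R -> R) (x t C : R) (k : nat).

(** Since f x = f'(z) x with |z| <= |x|, the order of vanishing rises by one with the same constant.
    The Taylor bounds below iterate this, each remainder being, up to sign, the derivative of the
    next. *)
Lemma mvt_bound f df C k x :
  (forall t, `|t| <= 1 -> is_derive t 1 f (df t)) -> f 0 = 0 ->
  (forall t, `|t| <= 1 -> `|df t| <= C * `|t| ^+ k) ->
  `|x| <= 1 -> `|f x| <= C * `|x| ^+ k.+1.
Proof.
move=> fd f0 dfb x1.
have [e|[z zx e]] : x = 0 \/ exists2 z, `|z| <= `|x| & f x = df z * x.
  have cw a b : -1 <= a -> b <= 1 -> {within `[a, b], continuous f}%classic.
    move=> a1 b1; apply: continuous_in_subspaceT => t;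
      rewrite inE/= in_itv/= => /andP[ta tb].
    have [dft _] := fd t (ltac:(rewrite ler_norml; lra)).
    exact/differentiable_continuous/derivable1_diffP.
  move: x1; rewrite ler_norml => /andP[xN x1].
  have [x0|x0|->] := ltgtP x 0; last by left.
  - right; have [|z zi] := @MVT R f df x 0 x0 _ (cw _ _ xN ler01).
      move=> t; rewrite in_itv/= => /andP[ta tb].
      by apply: fd; rewrite ler_norml; lra.
    move: zi; rewrite in_itv/= f0 => /andP[z1 z2] e; exists z.
      by rewrite !ltr0_norm//; lra.
    by lra.
  - right; have [|z zi] := @MVT R f df 0 x x0 _ (cw _ _ (lerN10 R) x1).
      move=> t; rewrite in_itv/= => /andP[ta tb].
      by apply: fd; rewrite ler_norml; lra.
    move: zi; rewrite in_itv/= f0 => /andP[z1 z2] e; exists z.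
      by rewrite !gtr0_norm//; lra.
    by lra.
- by rewrite e f0 normr0 expr0n/= mulr0.
- rewrite e normrM exprSr mulrA ler_wpM2r//.
  have C0 : 0 <= C by have := dfb 1; rewrite normr1 expr1n mulr1;
    move=> /(_ (lexx _)); apply: le_trans.
  by rewrite (le_trans (dfb z _))// ?(le_trans zx)// ler_wpM2l// lerXn2r ?nnegrE.
Qed.

Lemma cos_sub1 x : `|x| <= 1 -> `|cos x - 1| <= 1 * `|x| ^+ 1.
Proof.
have D t : is_derive t 1 (fun x => cos x - 1) (- sin t) by eapply is_derive_to;
  [do !derive_step|rewrite /=; ring].
apply: (mvt_bound (fun t _ => D t)) => /=.
- by rewrite cos0 subrr.
- by move=> t _; rewrite normrN expr0 mulr1 sin_max.
Qed.

Lemma sin_sub x : `|x| <= 1 -> `|sin x - x| <= 1 * `|x| ^+ 2.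
Proof.
have D t : is_derive t 1 (fun x => sin x - x) (cos t - 1) by eapply is_derive_to;
  [do !derive_step|rewrite /=; ring].
apply: (mvt_bound (fun t _ => D t)) => /=.
- by rewrite sin0 subrr.
- exact: cos_sub1.
Qed.

Lemma cos_taylor2 x : `|x| <= 1 -> `|cos x - 1 + x ^+ 2 / 2| <= 1 * `|x| ^+ 3.
Proof.
have D t : is_derive t 1 (fun x =>
  cos x - 1 + x ^+ 2 / 2) (- (sin t - t)) by eapply is_derive_to;
    [do !derive_step|rewrite /GRing.scale/=; field].
apply: (mvt_bound (fun t _ => D t)) => /=.
- by rewrite cos0 subrr expr0n/= mul0r add0r.
- by move=> t t1; rewrite normrN; exact: sin_sub.
Qed.

Lemma sin_taylor3 x : `|x| <= 1 -> `|sin x - x + x ^+ 3 / 6| <= 1 * `|x| ^+ 4.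
Proof.
have D t : is_derive t 1 (fun x =>
  sin x - x + x ^+ 3 / 6) (cos t - 1 + t ^+ 2 / 2) by eapply is_derive_to;
    [do !derive_step|rewrite /GRing.scale/=; field].
apply: (mvt_bound (fun t _ => D t)) => /=.
- by rewrite sin0 subrr expr0n/= mul0r add0r.
- exact: cos_taylor2.
Qed.

(** The sine has no quadratic term, so the remainder is cubic, as the next order shows. *)
Lemma sin_taylor1 x : `|x| <= 1 -> `|sin x - x| <= 2 * `|x| ^+ 3.
Proof.
move=> x1; have h := sin_taylor3 x1.
have -> : sin x - x = (sin x - x + x ^+ 3 / 6) - x ^+ 3 / 6 by ring.
rewrite (le_trans (ler_normB _ _))// normrM normrX.
have h0 : 0 <= `|x| ^+ 3 by exact: exprn_ge0.
have : `|x| ^+ 4 <= `|x| ^+ 3 by rewrite exprSr ler_piMr.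
by rewrite (gtr0_norm (_ : 0 < 6^-1))//; lra.
Qed.

Lemma cos_taylor3 x : `|x| <= 1 -> `|cos x - 1 + x ^+ 2 / 2| <= 2 * `|x| ^+ 4.
Proof.
have D t : is_derive t 1 (fun x =>
  cos x - 1 + x ^+ 2 / 2) (- (sin t - t)) by eapply is_derive_to;
    [do !derive_step|rewrite /GRing.scale/=; field].
apply: (mvt_bound (fun t _ => D t)) => /=.
- by rewrite cos0 subrr expr0n/= mul0r add0r.
- by move=> t t1; rewrite normrN; exact: sin_taylor1.
Qed.

Lemma expR_taylor0 x : `|x| <= 1 -> `|expR x - 1| <= expR 1 * `|x| ^+ 1.
Proof.
have D t : is_derive t 1 (fun x => expR x - 1) (expR t) by eapply is_derive_to;
  [do !derive_step|rewrite /=; ring].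
apply: (mvt_bound (fun t _ => D t)) => /=.
- by rewrite expR0 subrr.
- move=> t; rewrite ler_norml expr0 mulr1 => /andP[_ t1].
  by rewrite ger0_norm ?expR_ge0// ler_expR.
Qed.

Lemma expR_taylor1 x : `|x| <= 1 -> `|expR x - 1 - x| <= expR 1 * `|x| ^+ 2.
Proof.
have D t : is_derive t 1 (fun x =>
  expR x - 1 - x) (expR t - 1) by eapply is_derive_to; [do !derive_step|rewrite /=;
    ring].
apply: (mvt_bound (fun t _ => D t)) => /=.
- by rewrite expR0 subrr subr0.
- exact: expR_taylor0.
Qed.

Lemma expR_taylor2 x : `|x| <= 1 ->
  `|expR x - 1 - x - x ^+ 2 / 2| <= expR 1 * `|x| ^+ 3.
Proof.
have D t : is_derive t 1 (fun x =>
  expR x - 1 - x - x ^+ 2 / 2) (expR t - 1 - t) by eapply is_derive_to;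
    [do !derive_step|rewrite /GRing.scale/=; field].
apply: (mvt_bound (fun t _ => D t)) => /=.
- by rewrite expR0 subrr expr0n/= mul0r !subr0.
- exact: expR_taylor1.
Qed.

Lemma expR_taylor3 x : `|x| <= 1 ->
  `|expR x - 1 - x - x ^+ 2 / 2 - x ^+ 3 / 6| <= expR 1 * `|x| ^+ 4.
Proof.
have D t : is_derive t 1 (fun x =>
  expR x - 1 - x - x ^+ 2 / 2 - x ^+ 3 / 6) (expR t - 1 - t -
    t ^+ 2 / 2) by eapply is_derive_to; [do !derive_step|rewrite /GRing.scale/=;
      field].
apply: (mvt_bound (fun t _ => D t)) => /=.
- by rewrite expR0 subrr !expr0n/= !mul0r !subr0.
- exact: expR_taylor2.
Qed.

Lemma ln1D_bound x : `|x| <= 1 / 2 -> `|ln (1 + x)| <= 2 * `|x|.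
Proof.
rewrite ler_norml => /andP[x1 x2].
have up : ln (1 + x) <= x by apply: le_ln1Dx; lra.
(* The lower bound is the upper bound for the logarithm at (1 + x)^-1 = 1 - x / (1 + x). *)
have lo : x / (1 + x) <= ln (1 + x).
  have -> : ln (1 + x) = - ln (1 + x)^-1 by rewrite lnV ?opprK// posrE; lra.
  have e : (1 + x)^-1 = 1 + - (x / (1 + x)) by field; lra.
  rewrite [in X in _ <= X]e.
  rewrite lerNr; apply: le_ln1Dx; rewrite ltrN2 ltr_pdivrMr; lra.
have bd : - (2 * `|x|) <= x / (1 + x).
  rewrite ler_pdivlMr; last by lra.
  by have [x0|x0] := leP 0 x; [rewrite ger0_norm//|rewrite ltr0_norm//]; nra.
have := ler_norm x; rewrite ler_norml => ?; apply/andP; split; [lra|].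
by have := normr_ge0 x; lra.
Qed.

End Taylor.

(** * Uniform estimates *)

Section BigO.
Variables (R : realType) (T : Type) (F : set_system T).
Context {FF : Filter F}.
Variables (J h : T -> R).
Hypothesis J_ge1 : forall t, 1 <= J t.
Hypothesis h_gt0 : forall t, 0 < h t.
Hypothesis Jh_small : forall k e, 0 < e -> \forall t \near F, J t ^+ k * h t <= e.
Implicit Types (f g : T -> R) (a b c d k : nat).

(* [J] stands for [j] and [h] for [1 / (n + 2)]: bounds in both are uniform in
   [j], and [Jh_small] expresses that [j] is at most logarithmic in [n]. *)
Definition bigo a b f := exists C, \forall t \near F,
  `|f t| <= C * (J t ^+ a * h t ^+ b).

Lemma scale_ge0 a b t : 0 <= J t ^+ a * h t ^+ b.
Proof. by rewrite mulr_ge0 ?exprn_ge0 ?(ltW (h_gt0 t))// (le_trans ler01). Qed.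

Lemma bigo_pos a b f : bigo a b f ->
  exists2 C, 0 < C & \forall t \near F, `|f t| <= C * (J t ^+ a * h t ^+ b).
Proof.
case=> C HC; exists (`|C| + 1); first by rewrite ltr_wpDl.
apply: filterS HC => t /le_trans; apply; rewrite ler_wpM2r ?scale_ge0//.
by have := ler_norm C; lra.
Qed.

Lemma bigo_near a b f g : (\forall t \near F, f t = g t) -> bigo a b f -> bigo a b g.
Proof.
by move=> fg [C HC]; exists C; apply: filterS2 fg HC => t ->.
Qed.

Lemma bigo_eq a b f g : (forall t, f t = g t) -> bigo a b f -> bigo a b g.
Proof. by move=> fg; apply: bigo_near; apply: filterE. Qed.

Lemma bigo_le a b f g : (\forall t \near F,
  `|g t| <= `|f t|) -> bigo a b f -> bigo a b g.
Proof. by move=> fg [C HC]; exists C; apply: filterS2 fg HC => t;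
  apply: le_trans. Qed.

Lemma bigo_add a b f g : bigo a b f -> bigo a b g -> bigo a b (fun t => f t + g t).
Proof.
move=> [C HC] [D HD]; exists (C + D); apply: filterS2 HC HD => t Ct Dt.
by rewrite (le_trans (ler_normD _ _))// mulrDl lerD.
Qed.

Lemma bigo_opp a b f : bigo a b f -> bigo a b (fun t => - f t).
Proof. by move=> [C HC]; exists C; apply: filterS HC => t; rewrite normrN. Qed.

Lemma bigo_mul a b c d f g : bigo a b f -> bigo c d g ->
  bigo (a + c) (b + d) (fun t => f t * g t).
Proof.
move=> [C HC] [D HD]; exists (C * D); apply: filterS2 HC HD => t Ct Dt.
rewrite normrM !exprD.
rewrite (_ : C * D * _ = (C * (J t ^+ a * h t ^+ b)) * (D * (J t ^+ c * h t ^+ d)));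
  last by ring.
by apply: ler_pM.
Qed.

Lemma bigo_cst (x : R) : bigo 0 0 (fun=> x).
Proof. by exists `|x|; apply: filterE => t; rewrite !expr0 !mulr1. Qed.

Lemma bigo_exp a b f k : bigo a b f -> bigo (k * a) (k * b) (fun t => f t ^+ k).
Proof.
move=> fO; elim: k => [|k IH]; first by apply: bigo_eq (bigo_cst 1) => t;
  rewrite expr0.
by rewrite !mulSn; apply: bigo_eq (bigo_mul fO IH) => t; rewrite exprS.
Qed.

Lemma h_le1 : \forall t \near F, h t <= 1.
Proof. by apply: filterS (Jh_small 0 ltr01) => t; rewrite expr0 mul1r. Qed.

(** A spare power of [h] absorbs any power of [J] by [Jh_small]; the powers of [J] need comparing
    only when no power of [h] is lost. *)
Lemma bigo_weak a b c d f :
  bigo a b f -> ((a <= c) && (d <= b) || (d < b))%N -> bigo c d f.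
Proof.
move=> /bigo_pos[C C0 HC] cond; exists C.
apply: filterS3 HC h_le1 (Jh_small a ltr01) => t Ct h1 Jh1.
have h0 := ltW (h_gt0 t); have J1 := J_ge1 t; have J0 := le_trans ler01 J1.
rewrite (le_trans Ct)// ler_wpM2l ?(ltW C0)//.
case/orP: cond => [/andP[ac db]|db].
  apply: ler_pM; [exact: exprn_ge0|exact: exprn_ge0|exact: ler_weXn2l|exact:
    ler_wiXn2l].
have -> : J t ^+ a * h t ^+ b = h t ^+ (b - d).-1 * (J t ^+ a * h t * h t ^+ d).
  by rewrite {1}(_ : b = ((b - d).-1 + d.+1)%N) ?exprD ?exprS; [ring|lia].
have x1 : h t ^+ (b - d).-1 <= 1 by exact: exprn_ile1.
rewrite -[leRHS]mul1r; apply: ler_pM; rewrite ?exprn_ge0 ?mulr_ge0 ?exprn_ge0//.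
apply: ler_pM; rewrite ?mulr_ge0 ?exprn_ge0//.
by rewrite (le_trans Jh1)// exprn_ege1.
Qed.

Lemma bigo_h : bigo 0 1 h.
Proof. by exists 1; apply: filterE => t; rewrite expr0 !mul1r ger0_norm// ltW. Qed.

Lemma bigo_small a b f e : bigo a b.+1 f -> 0 < e -> \forall t \near F, `|f t| <= e.
Proof.
move=> /bigo_pos[C C0 HC] e0; apply: filterS3 HC h_le1 (Jh_small a (divr_gt0 e0 C0))
  => t Ct h1 Jh.
have h0 := ltW (h_gt0 t); rewrite (le_trans Ct)//.
rewrite mulrC -ler_pdivlMr// (le_trans _ Jh)// exprS mulrA ler_piMr//.
  by rewrite mulr_ge0// exprn_ge0// (le_trans ler01).
exact: exprn_ile1.
Qed.

(** Since [f] carries a positive power of [h], it is eventually in [-1, 1], where the Taylor bounds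
    apply. *)
Lemma bigo_comp a b f k (C : R) (phi : R -> R) :
  (forall x, `|x| <= 1 -> `|phi x| <= C * `|x| ^+ k) ->
  bigo a b.+1 f -> bigo (k * a) (k * b.+1) (fun t => phi (f t)).
Proof.
move=> phiC fO; have [D HD] := bigo_exp k fO.
have C0 : 0 <= C.
  by have := phiC 1; rewrite normr1 expr1n mulr1 => /(_ (lexx _)); apply: le_trans.
exists (C * D); apply: filterS2 HD (bigo_small fO ltr01) => t Dt ft.
by rewrite (le_trans (phiC _ ft))// -mulrA ler_wpM2l// -normrX.
Qed.

Lemma bigo_div_h a b f g : (forall t, h t * g t = f t) -> bigo a b.+1 f -> bigo a b g.
Proof.
move=> hg [C HC]; exists C; apply: filterS HC => t.
rewrite -hg normrM gtr0_norm// => H; rewrite -(ler_pM2l (h_gt0 t)) (le_trans H)//.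
by rewrite le_eqVlt; apply/orP; left; apply/eqP; rewrite exprS; ring.
Qed.

Lemma bigo_add_max a b c d f g : bigo a b f -> bigo c d g ->
  bigo (maxn a c) (minn b d) (fun t => f t + g t).
Proof.
move=> fO gO; apply: bigo_add.
  by apply: bigo_weak fO _; rewrite leq_maxl geq_minl.
by apply: bigo_weak gO _; rewrite leq_maxr geq_minr.
Qed.

End BigO.

(** The exponents are metavariables, filled in from the shape of the expression. *)
Ltac bigo_infer :=
  lazymatch goal with
  | |- bigo _ _ _ _ _ (fun t => _ * _) =>
      eapply bigo_mul; [typeclasses eauto|bigo_infer|bigo_infer]
  | |- bigo _ _ _ _ _ (fun t => _ ^+ _) => eapply bigo_exp;
    [typeclasses eauto|bigo_infer]
  | |- bigo _ _ _ _ _ (fun t => _ + _) =>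
      eapply bigo_add_max;
        [typeclasses eauto|eassumption|eassumption|eassumption|bigo_infer|bigo_infer]
  | |- bigo _ _ _ _ _ (fun t => - _) => eapply bigo_opp;
    [typeclasses eauto|bigo_infer]
  | |- _ => first [eassumption | eapply bigo_cst; typeclasses eauto]
  end.

(** Sums are split first, so that each summand is weakened on its own to the target exponents;
    [reflexivity] decides the comparison by computation. *)
Ltac bigo_tac :=
  lazymatch goal with
  | |- bigo _ _ _ _ _ (fun t => _ + _) =>
      eapply bigo_add; [typeclasses eauto|bigo_tac|bigo_tac]
  | |- bigo _ _ _ _ _ (fun t => - _) => eapply bigo_opp; [typeclasses eauto|bigo_tac]
  | |- _ => eapply bigo_weak;
        [typeclasses eauto|eassumption|eassumption|eassumption|bigo_infer|reflexivity]
  end.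

(** * Expansion of the secular function *)

Section Expansion.
Variables (R : realType) (T : Type) (F : set_system T).
Context {FF : Filter F}.
Variables (J h : T -> R).
Hypothesis J_ge1 : forall t, 1 <= J t.
Hypothesis h_gt0 : forall t, 0 < h t.
Hypothesis Jh_small : forall k e, 0 < e -> \forall t \near F, J t ^+ k * h t <= e.

Local Notation O := (bigo F J h).
Local Notation s3 := (Num.sqrt 3 : R).

Lemma bigo_expR a b f : O a b.+1 f -> O 0 0 (fun t => expR (f t)).
Proof.
move=> fO; exists (expR 1); apply: filterS (bigo_small J_ge1 h_gt0 Jh_small fO ltr01)
  => t.
rewrite ler_norml !expr0 !mulr1 => /andP[_ f1].
by rewrite ger0_norm ?expR_ge0// ler_expR.
Qed.

Lemma bigo_ln1D a b f : O a b.+1 f -> O a b.+1 (fun t => ln (1 + f t)).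
Proof.
move=> fO; have h2 : 0 < 1 / 2 :> R by lra.
have [C HC] := fO; exists (2 * C).
apply: filterS2 HC (bigo_small J_ge1 h_gt0 Jh_small fO h2) => t Ct ft.
by rewrite (le_trans (ln1D_bound ft))// -mulrA ler_pM2l.
Qed.

(** [g] stands for phi, [eta] is a free perturbation, and [w] and [- (s * u)] will be the cosine and
    sine of pi delta. Hypothesis [u_O] expresses that the exponentially small [u] absorbs every
    power of [J]. *)
Variables (N : T -> nat) (g psi tau eta u w s : T -> R).
Hypothesis Nh : forall t, (N t)%:R * h t = 1.
Hypothesis g_O : O 1 0 g.
Hypothesis psi_O : O 0 0 psi.
Hypothesis tau_O : O 2 0 tau.
Hypothesis eta_O : O 0 2 eta.
Hypothesis w_O : O 0 0 w.
Hypothesis s_O : O 0 0 s.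
Hypothesis u_O : forall a b f, O a b f -> O 0 b (fun t => u t * f t).
Hypothesis uE : forall t, u t = expR (- (s3 * pi * g t)) / 2.

(** Up to the contribution of [eta], the coefficients of h and h^2 in the exponent [z] below, for
    which c^-N = 2 u e^z. *)
Let z1 t := - (s3 * pi) * psi t + 2 * pi ^+ 2 * g t ^+ 2.
Let z2 t := - (s3 * pi) * tau t + 4 * pi ^+ 2 * (g t * psi t)
  - 4 * s3 / 3 * pi ^+ 3 * g t ^+ 3.

(* [order1] and [order2] are the vanishing of the coefficients of [h] and
   [h ^+ 2] in the expansion. *)
Hypothesis order1 : forall t, w t * (pi * psi t) + s t * u t * z1 t = 0.
Hypothesis order2 : forall t,
  w t * (pi * tau t - 2 * s3 / 3 * pi ^+ 2 * g t ^+ 2)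
  + s t * u t * (z2 t + z1 t ^+ 2 / 2 - 2 * pi ^+ 2 * g t ^+ 2
                 + pi ^+ 2 * psi t ^+ 2 / 2) = 0.

(** Here x = pi alpha, c = 2 cos theta, and [tt] is the coefficient of the cosine once the amplitude
    of the sine is divided out. *)
Let eps t := psi t * h t + tau t * h t ^+ 2 + eta t.
Let gam t := g t + eps t.
Let x t := pi * gam t * h t.
Let c t := cos (x t) + s3 * sin (x t).
Let tt t := (1 - cos (2 * x t)) / (s3 + sin (2 * x t)).

Let h_O : O 0 1 h.
Proof. exact: bigo_h. Qed.

Let eps_O : O 0 1 eps.
Proof. by rewrite /eps; bigo_tac. Qed.

Let gam_O : O 1 0 gam.
Proof. by rewrite /gam; bigo_tac. Qed.

Let x_O : O 1 1 x.
Proof. by rewrite /x; bigo_tac. Qed.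

Let z1_O : O 2 0 z1.
Proof. by rewrite /z1; bigo_tac. Qed.

Let z2_O : O 3 0 z2.
Proof. by rewrite /z2; bigo_tac. Qed.

Let x2_O : O 3 3 (fun t => x t ^+ 2 - pi ^+ 2 * g t ^+ 2 * h t ^+ 2).
Proof.
apply: (@bigo_eq _ _ _ _ _ _ _ _ (fun t =>
  pi ^+ 2 * h t ^+ 2 * (2 * g t * eps t + eps t ^+ 2))).
  by move=> t; rewrite /x /gam; ring.
by bigo_tac.
Qed.

Let y t := s3 * x t - 2 * x t ^+ 2 + 4 * s3 / 3 * x t ^+ 3.

Let y_O : O 1 1 y.
Proof. by rewrite /y; bigo_tac. Qed.

(* [y] is the Taylor polynomial of [ln c]; comparing [c] with [expR y] avoids
   differentiating the logarithm. *)
Let c_expR_O : O 4 4 (fun t => c t - expR (y t)).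
Proof.
have ey_O : O 4 4 (fun t => expR (y t) - 1 - y t - y t ^+ 2 / 2 - y t ^+ 3 / 6).
  exact: (bigo_comp J_ge1 h_gt0 Jh_small (@expR_taylor3 R) y_O).
have sx_O : O 4 4 (fun t => sin (x t) - x t + x t ^+ 3 / 6).
  exact: (bigo_comp J_ge1 h_gt0 Jh_small (@sin_taylor3 R) x_O).
have cx_O : O 4 4 (fun t => cos (x t) - 1 + x t ^+ 2 / 2).
  exact: (bigo_comp J_ge1 h_gt0 Jh_small (@cos_taylor3 R) x_O).
pose q t := s3 - 2 * x t + 4 * s3 / 3 * x t ^+ 2.
have q_O : O 0 0 q by rewrite /q; bigo_tac.
(* [x ^+ 4 * P] is the difference of the Taylor polynomials of [c] and [expR y], with y = x q; its
   terms of degree below 4 cancel. *)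
pose P t := - 6 + 8 * s3 / 3 * x t - 8 / 3 * x t ^+ 2
  - (- 2 + 4 * s3 / 3 * x t) * (q t ^+ 2 + q t * s3 + 3) * 6^-1.
have P_O : O 0 0 P.
  (* With x weakened to O(1), the power of [J] inferred for sums inside products stays 0. *)
  suff poly_O X : O 0 0 X -> let qX t := s3 - 2 * X t + 4 * s3 / 3 * X t ^+ 2 in
      O 0 0 (fun t => - 6 + 8 * s3 / 3 * X t - 8 / 3 * X t ^+ 2
        - (- 2 + 4 * s3 / 3 * X t) * (qX t ^+ 2 + qX t * s3 + 3) * 6^-1).
    have x0_O : O 0 0 x by exact: bigo_weak x_O _.
    exact: (poly_O x x0_O).
  move=> X_O qX; have qX_O : O 0 0 qX by rewrite /qX; bigo_tac.
  by bigo_tac.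
pose r1 t := cos (x t) - 1 + x t ^+ 2 / 2.
pose r2 t := sin (x t) - x t + x t ^+ 3 / 6.
pose r3 t := expR (y t) - 1 - y t - y t ^+ 2 / 2 - y t ^+ 3 / 6.
apply: (@bigo_eq _ _ _ _ _ _ _ _ (fun t =>
  r1 t + s3 * r2 t - r3 t + x t ^+ 4 * P t)); last first.
  by change (O 4 4 r1) in cx_O; change (O 4 4 r2) in sx_O; change (O 4 4 r3) in ey_O;
    bigo_tac.
move=> t; rewrite /r1 /r2 /r3 /P /c /y /q.
by field: (sqr_s3 R).
Qed.

(** Writing c = e^y (1 + d) with d of order 4, this is - N (ln c - y); the factor N costs one power
    of h. *)
Let e1 t := - ((N t)%:R * ln (1 + (c t - expR (y t)) * expR (- y t))).

Let d_O : O 4 4 (fun t => (c t - expR (y t)) * expR (- y t)).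
Proof.
have yN_O : O 1 1 (fun t => - y t) by bigo_tac.
have ey_O := bigo_expR yN_O.
pose r1 t := c t - expR (y t); pose r2 t := expR (- y t).
by change (O 4 4 r1) in c_expR_O; change (O 0 0 r2) in ey_O;
  change (O 4 4 (fun t => r1 t * r2 t)); bigo_tac.
Qed.

Let e1_O : O 4 3 e1.
Proof.
apply: bigo_opp; apply: (bigo_div_h h_gt0 _ (bigo_ln1D d_O)) => t.
by rewrite mulrA (mulrC (h t)) Nh mul1r.
Qed.

(** What remains of - N ln c once - sqrt 3 pi g, the source of the factor 2 u, is removed. *)
Let z t := - (s3 * pi) * eps t + 2 * pi ^+ 2 * gam t ^+ 2 * h t
  - 4 * s3 / 3 * pi ^+ 3 * gam t ^+ 3 * h t ^+ 2 + e1 t.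

Let c_pow : \forall t \near F, (c t ^+ N t)^-1 = 2 * u t * expR (z t).
Proof.
have h2 : 0 < 1 / 2 :> R by lra.
apply: filterS (bigo_small J_ge1 h_gt0 Jh_small d_O h2) => t.
rewrite ler_norml => /andP[d1 d2].
have := Nh t; rewrite /z /e1; set d := _ * expR (- y t) in d1 d2 * => Nht.
have -> : c t = expR (y t + ln (1 + d)).
  rewrite expRD lnK; last by rewrite posrE; lra.
  by rewrite mulrDr mulr1 /d mulrCA expRxMexpNx_1; ring.
rewrite -expRM_natl -expRN uE (mulrC 2) divfK// -expRD.
congr expR; rewrite mulrDr opprD /y /x.
have -> : (N t)%:R * (s3 * (pi * gam t * h t) - 2 * (pi * gam t * h t) ^+ 2 +
   4 * s3 / 3 * (pi * gam t * h t) ^+ 3) = (N t)%:R * h t * (s3 * (pi * gam t) -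
     2 * (pi * gam t) ^+ 2 * h t +
   4 * s3 / 3 * (pi * gam t) ^+ 3 * h t ^+ 2) by field.
by rewrite Nht /gam; field.
Qed.

Let z_O : O 2 1 z.
Proof. by rewrite /z; bigo_tac. Qed.

(** The linear term in [eta] is kept apart from the remainder: it is the one that will produce the
    change of sign. *)
Let zz t := z t - (z1 t * h t + z2 t * h t ^+ 2 - s3 * pi * eta t).

Let zz_O : O 4 3 zz.
Proof.
apply: (@bigo_eq _ _ _ _ _ _ _ _ (fun t => 2 * pi ^+ 2 * h t *
   (2 * g t * (tau t * h t ^+ 2 + eta t) + eps t ^+ 2)
   - 4 * s3 / 3 * pi ^+ 3 * h t ^+ 2 *
   (3 * g t ^+ 2 * eps t + 3 * g t * eps t ^+ 2 + eps t ^+ 3) + e1 t)).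
  by move=> t; rewrite /zz /z /z1 /z2 /gam /eps; ring.
by bigo_tac.
Qed.

Let q t := expR (z t) - (1 + z1 t * h t + (z2 t + z1 t ^+ 2 / 2) * h t ^+ 2 -
  s3 * pi * eta t).

Let q_O : O 6 3 q.
Proof.
pose r t := expR (z t) - 1 - z t - z t ^+ 2 / 2.
have r_O : O 6 3 r by exact: (bigo_comp J_ge1 h_gt0 Jh_small (@expR_taylor2 R) z_O).
pose zr t := z2 t * h t ^+ 2 - s3 * pi * eta t + zz t.
have zr_O : O 3 2 zr by rewrite /zr; bigo_tac.
apply: (@bigo_eq _ _ _ _ _ _ _ _ (fun t =>
  r t + zz t + zr t * (z t + z1 t * h t) * 2^-1)); last by bigo_tac.
by move=> t; rewrite /q /r /zr /zz; field.
Qed.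

Let den t := (s3 + sin (2 * x t))^-1.

Let den_gt0 t : 0 < s3 + sin (2 * x t).
Proof. by have := sin_geN1 (2 * x t); have /andP[] := s3_bound R; lra. Qed.

Let den_O : O 0 0 den.
Proof.
exists 2; apply: filterE => t; rewrite /den !expr0 !mulr1.
rewrite gtr0_norm ?invr_gt0// -[leRHS]invrK lef_pV2 ?posrE// ?invr_gt0//.
by have := sin_geN1 (2 * x t); have /andP[] := s3_bound R; lra.
Qed.

Let t1 t := tt t - 2 * s3 / 3 * pi ^+ 2 * g t ^+ 2 * h t ^+ 2.

Let t1_O : O 3 3 t1.
Proof.
have x2O : O 1 1 (fun t => 2 * x t) by bigo_tac.
pose r1 t := cos (2 * x t) - 1 + (2 * x t) ^+ 2 / 2.
have r1_O : O 3 3 r1 by exact: (bigo_comp J_ge1 h_gt0 Jh_small (@cos_taylor2 R) x2O).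
pose r2 t := sin (2 * x t) - 2 * x t.
have r2_O : O 2 2 r2 by exact: (bigo_comp J_ge1 h_gt0 Jh_small (@sin_sub R) x2O).
have sin2_O : O 1 1 (fun t => r2 t + 2 * x t) by bigo_tac.
pose r4 t := r2 t + 2 * x t; change (O 1 1 r4) in sin2_O.
pose r3 t := x t ^+ 2 - pi ^+ 2 * g t ^+ 2 * h t ^+ 2.
change (O 3 3 r3) in x2_O.
apply: (@bigo_eq _ _ _ _ _ _ _ _ (fun t => 2 * s3 / 3 * r3 t
   - (r1 t + 2 * s3 / 3 * x t ^+ 2 * r4 t) * den t)); last by bigo_tac.
move=> t; rewrite /t1 /tt /r1 /r4 /r2 /r3 /den; have := lt0r_neq0 (den_gt0 t).
by move=> dN0; field: (sqr_s3 R).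
Qed.

Let tt_O : O 2 2 tt.
Proof.
apply: (@bigo_eq _ _ _ _ _ _ _ _ (fun t =>
  t1 t + 2 * s3 / 3 * pi ^+ 2 * g t ^+ 2 * h t ^+ 2)).
  by move=> t; rewrite /t1 subrK.
by bigo_tac.
Qed.

Lemma secular_expansion (delta : T -> R) :
  (forall t, sin (pi * delta t) = - (s t * u t)) ->
  (forall t, cos (pi * delta t) = w t) ->
  O 3 3 (fun t => sin (pi * (delta t + eps t)) - tt t * cos (pi * (delta t + eps t))
    + s t / 2 * (1 - s3 * tt t) / c t ^+ N t - pi * (w t - s3 * (s t * u t)) * eta t).
Proof.
move=> sd cd.
have pe_O : O 0 1 (fun t => pi * eps t) by bigo_tac.
pose S t := sin (pi * eps t) - pi * eps t.
have S_O : O 0 3 S by exact: (bigo_comp J_ge1 h_gt0 Jh_small (@sin_taylor1 R) pe_O).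
pose Cc t := cos (pi * eps t) - 1 + (pi * eps t) ^+ 2 / 2.
have Cc_O : O 0 3 Cc by exact: (bigo_comp J_ge1 h_gt0 Jh_small (@cos_taylor2 R) pe_O).
pose e0 t := expR (z t) - 1.
have e0_O : O 2 1 e0 by exact: (bigo_comp J_ge1 h_gt0 Jh_small (@expR_taylor0 R) z_O).
(* [B1] collects the remainders multiplied by w, and [B2] those multiplied by s u, whose factor J^6
   is then absorbed by [u]. *)
pose B1 t := S t - t1 t - tt t * (Cc t - (pi * eps t) ^+ 2 / 2).
have B1_O : O 3 3 B1 by rewrite /B1; bigo_tac.
pose B2 t := q t - s3 * t1 t - s3 * tt t * e0 t
  + pi ^+ 2 / 2 * ((tau t * h t ^+ 2 + eta t) * (eps t + psi t * h t)) - Cc t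
  - tt t * (S t + pi * eps t).
have B2_O : O 6 3 B2 by rewrite /B2; bigo_tac.
have uB2_O := u_O B2_O.
pose uB2 t := u t * B2 t; change (O 0 3 uB2) in uB2_O.
apply: (@bigo_near _ _ _ _ _ _ _ _ (fun t => w t * B1 t + s t * uB2 t));
  last by bigo_tac.
apply: filterS c_pow => t cE.
rewrite cE.
have -> : sin (pi * (delta t + eps t)) = -
  (s t * u t) * cos (pi * eps t) + w t * sin (pi * eps t).
  by rewrite mulrDr sinD sd cd.
have -> : cos (pi * (delta t + eps t)) = w t * cos (pi * eps t) +
  s t * u t * sin (pi * eps t).
  by rewrite mulrDr cosD sd cd mulNr opprK.
have o1 := order1 t; have o2 := order2 t.
(* Adding the vanishing combinations of orders 1 and 2 leaves a polynomial identity modulo s3^2 =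
   3. *)
have -> : w t * B1 t + s t * uB2 t = w t * B1 t + s t * uB2 t +
  h t * (w t * (pi * psi t) + s t * u t * z1 t) + h t ^+ 2 *
  (w t * (pi * tau t - 2 * s3 / 3 * pi ^+ 2 * g t ^+ 2)
  + s t * u t * (z2 t + z1 t ^+ 2 / 2 - 2 * pi ^+ 2 * g t ^+ 2
                 + pi ^+ 2 * psi t ^+ 2 / 2)) by rewrite o1 o2 !mulr0 !addr0.
rewrite /uB2 /B1 /B2 /S /Cc /e0 /q /t1.
move: (sin (pi * eps t)) (cos (pi * eps t)) (expR (z t)) (tt t) => sp cp ez tz.
rewrite /eps.
move: (z1 t) (z2 t) => a b; by field: (sqr_s3 R).
Qed.

End Expansion.

(** * The phase and the functions omega *)

Section Phase.
Variable R : realType.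
Implicit Types (n j r : nat) (gam y : R).

Local Notation s3 := (Num.sqrt 3 : R).

Lemma two_cos_theta (x : R) : 2 * cos (pi / 3 - x) = cos x + s3 * sin x.
Proof. by rewrite cosB cos_pi3 sin_pi3; field. Qed.

(** Both sines are rewritten with the phase pi delta, and the amplitude sqrt 3 + sin (2 x) is taken
    out. In the last term, sin theta = sin (2 theta) / c supplies the missing power of c. *)
Lemma secular_phase n j gam :
  let x := pi * gam * n.+2%:R^-1 in
  let delta := gam - j%:R + 2^-1 - (n %% 3)%:R / 3 in
  let tt := (1 - cos (2 * x)) / (s3 + sin (2 * x)) in
  let c := cos x + s3 * sin x in
  c != 0 ->
  secular_alpha n (gam * n.+2%:R^-1) =
  c ^+ n.+1 * (-1) ^+ (n %/ 3 + j) * (s3 + sin (2 * x)) *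
  (sin (pi * delta) - tt * cos (pi * delta)
   + (-1) ^+ (n %% 3 + j) / 2 * (1 - s3 * tt) / c ^+ n.+2).
Proof.
move=> x delta tt c c0; rewrite /secular_alpha /secular.
have th : pi / 3 - pi * (gam / n.+2%:R) = pi / 3 - x by rewrite /x; ring.
rewrite th; set theta := pi / 3 - x.
have cE : 2 * cos theta = c by exact: two_cos_theta.
have nE : n.+2%:R = (n %/ 3)%:R * 3 + (n %% 3)%:R + 2 :> R.
  by rewrite -[in LHS]addn2 [in LHS](divn_eq n 3) !natrD natrM.
have nN0 : n.+2%:R != 0 :> R by rewrite pnatr_eq0.
have dN0 : s3 + sin (2 * x) != 0.
  by have := sin_geN1 (2 * x); have /andP[] := s3_bound R; lra.
(* Since n + 2 = 3 (n/3) + r + 2, N theta is pi / 6 - pi delta up to an integer multiple of pi,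
   whence the signs. *)
have phaseE : n.+2%:R * theta + pi *+ j = (pi / 6 - pi * delta) + pi *+ (n %/ 3).+1.
  have xE : n.+2%:R * x = pi * gam by rewrite /x; field.
  have -> : n.+2%:R * theta = n.+2%:R * (pi / 3) -
    pi * gam by rewrite /theta mulrBr xE.
  by rewrite nE /delta -(mulr_natr pi j) -(mulr_natr pi _.+1) -natr1; field.
have sN : sin (n.+2%:R * theta) = - (-1) ^+ (n %/ 3 + j) * sin (pi / 6 - pi * delta).
  have := congr1 (@sin R) phaseE; rewrite !(alternatingn (@sinDpi R)) => e.
  by rewrite -[LHS](signrMK j) e exprS exprD; ring.
have cN : cos (n.+2%:R * theta) = - (-1) ^+ (n %/ 3 + j) * cos (pi / 6 - pi * delta).
  have := congr1 (@cos R) phaseE; rewrite !(alternatingn (@cosDpi R)) => e.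
  by rewrite -[LHS](signrMK j) e exprS exprD; ring.
have -> : sin (n%:R * theta) = sin (n.+2%:R * theta - 2 * theta).
  by congr sin; rewrite -addn2 natrD; ring.
have p6 : pi / 6 = pi / 2 - pi / 3 :> R by field.
have s6 : sin (pi / 6) = 2^-1 :> R.
  by rewrite p6 sinB sin_pihalf cos_pihalf cos_pi3 sin_pi3; ring.
have c6 : cos (pi / 6) = s3 / 2 :> R.
  by rewrite p6 cosB sin_pihalf cos_pihalf cos_pi3 sin_pi3; ring.
have t2 : 2 * theta = pi - (pi / 3 + 2 * x) by rewrite /theta; field.
have s2 : sin (2 * theta) = s3 / 2 * cos (2 * x) + 2^-1 * sin (2 * x).
  by rewrite t2 sinBpi sinD cos_pi3 sin_pi3.
have c2 : cos (2 * theta) = s3 / 2 * sin (2 * x) - 2^-1 * cos (2 * x).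
  by rewrite t2 cosB cospi sinpi cosD cos_pi3 sin_pi3; ring.
have sth : sin theta = sin (2 * theta) / c.
  have -> : sin (2 * theta) = sin theta * c.
    by rewrite (sin_addnS 0) mul1r mul0r sin0 subr0 cE mulrC.
  by rewrite mulfK.
have sgn : (-1) ^+ n = (-1) ^+ (n %/ 3 + j) * (-1) ^+ (n %% 3 + j) :> R.
  rewrite -exprD -signr_odd -[RHS]signr_odd; congr (_ ^+ _).
  by rewrite [in LHS](divn_eq n 3) !oddD oddM /= andbT; case: odd; case: odd;
    case: odd.
set D := s3 + sin (2 * x) in dN0 *;
  have ttD : D * tt = 1 - cos (2 * x) by rewrite /tt mulrCA divff ?mulr1.
have cX : c ^+ n.+1 / c ^+ n.+2 = c^-1 by rewrite [c ^+ n.+2]exprSr invfM mulrA divff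
  ?mul1r// expf_neq0.
set a : R := (-1) ^+ (n %/ 3 + j) in sN cN sgn *;
  set b : R := (-1) ^+ (n %% 3 + j) in sgn *.
have -> : c ^+ n.+1 * a * D * (sin (pi * delta) - tt * cos (pi * delta)
    + b / 2 * (1 - s3 * tt) / c ^+ n.+2) =
    c ^+ n.+1 * a * (D * sin (pi * delta) - D * tt * cos (pi * delta))
    + a * b / 2 * (D - s3 * (D * tt)) * (c ^+ n.+1 / c ^+ n.+2) by ring.
rewrite cX ttD sgn sth cE [sin (_ - 2 * theta)]sinB s2 c2 sN cN sinB cosB s6 c6 /D.
clear; move: (c ^+ n.+1) c^-1 a b (sin (2 * x)) (cos (2 * x)) (sin (pi * delta)) (cos
  (pi * delta)).
by move=> X k a b p q p' q'; field: (sqr_s3 R).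
Qed.

(** * The zero phi of omega0 and the derivatives there *)

Definition damp y : R := 2^-1 * expR (- (s3 * pi * y)).

(** The tangent of [asin (damp y)]. The fractional powers in [omega1] and [omega2] are powers of its
    inverse, and its derivative is a polynomial in itself. *)
Definition damp_tan y : R := damp y / Num.sqrt (1 - damp y ^+ 2).

Lemma damp_gt0 y : 0 < damp y.
Proof. by rewrite mulr_gt0 ?expR_gt0. Qed.

Lemma damp_le y : 0 <= y -> damp y <= 2^-1.
Proof.
move=> y0; rewrite ger_pMr// expR_le1 oppr_le0 !mulr_ge0 ?pi_ge0//.
Qed.

Lemma damp_cos_gt0 y : 0 <= y -> 0 < 1 - damp y ^+ 2.
Proof. by move=> y0; have := damp_gt0 y; have := damp_le y0; nra. Qed.

Lemma asin_half_bound (u : R) : 0 < u <= 2^-1 -> 0 < asin u <= pi / 6.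
Proof.
move=> /andP[u0 u2]; have pi0 := @pi_gt0 R.
have ui : -1 <= u <= 1 by lra.
have := asin_geNpi2 ui; have := asin_lepi2 ui => a1 a2.
have sa : sin (asin u) = u by rewrite asinK// in_itv.
have s6 : sin (pi / 6) = 2^-1 :> R.
  have -> : pi / 6 = pi / 2 - pi / 3 :> R by field.
  by rewrite sinB sin_pihalf cos_pihalf cos_pi3 sin_pi3; ring.
apply/andP; split.
  by rewrite -ltr_sin ?in_itv/= ?a1 ?a2 ?sin0 ?sa//; lra.
rewrite leNgt -ltr_sin ?in_itv/= ?a1 ?a2 ?s6 ?sa -?leNgt//; lra.
Qed.

Section Root.
Variables r j : nat.
Hypothesis r3 : (r < 3)%N.
Hypothesis j1 : (0 < j)%N.
Let s : R := (-1) ^+ (r + j).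

Lemma omega0_damp y : omega0 r j y =
  y - j%:R + 2^-1 - r%:R / 3 + s / pi * asin (damp y).
Proof. by []. Qed.

Lemma asin_damp_bound y : 0 <= y -> `|s / pi * asin (damp y)| <= 1 / 6.
Proof.
move=> y0; have pi0 := @pi_gt0 R.
have du : 0 < damp y <= 2^-1 by rewrite damp_gt0 damp_le.
have /andP[a0 a6] := asin_half_bound du.
have -> : s / pi * asin (damp y) = s * (asin (damp y) / pi) by ring.
rewrite normrM normr_sign mul1r ger0_norm; last by rewrite divr_ge0 ?ltW.
by rewrite mul1r ler_pdivrMr//; lra.
Qed.

Lemma is_derive_damp y : is_derive y 1 damp (- (s3 * pi) * damp y).
Proof.
rewrite /damp; eapply is_derive_to; first by do !derive_step.
by rewrite /GRing.scale/=; ring.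
Qed.

Lemma is_derive_omega0 y : 0 <= y -> is_derive y 1 (omega0 r j) (1 -
  s3 * (s * damp_tan y)).
Proof.
move=> y0; have pi0 := @pi_gt0 R.
have d0 := damp_gt0 y; have d2 := damp_le y0.
have da : is_derive (damp y) 1 (@asin R) (Num.sqrt (1 - damp y ^+ 2))^-1.
  by apply: is_derive1_asin; lra.
have dc := is_derive_fun_comp da (is_derive_damp y).
have dl := is_derive_fun_mul (is_derive_fun_cst (s / pi) y) dc.
have dy := is_derive_fun_add (is_derive_fun_id y) (is_derive_fun_cst (- j%:R + 2^-1 -
  r%:R / 3) y).
have -> : omega0 r j = (fun y => y + (- j%:R + 2^-1 -
  r%:R / 3) + s / pi * asin (damp y)).
  by apply/funext => z; rewrite omega0_damp; ring.
eapply is_derive_to; first exact: is_derive_fun_add dy dl.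
have w0 : Num.sqrt (1 - damp y ^+ 2) != 0 by rewrite gt_eqF// sqrtr_gt0 damp_cos_gt0.
rewrite /damp_tan; move: (lt0r_neq0 pi0) w0;
  move: (damp y) (asin _) (Num.sqrt _) (pi : R).
by move=> a b c p p0 c0; field; rewrite p0 c0.
Qed.

(** The arcsine term is at most 1/6 in modulus, so [omega0] changes sign on [0, j + 1], and [xget]
    returns a genuine zero rather than its default. *)
Lemma phiP : 0 <= phi r j :> R /\ omega0 r j (phi r j) = 0 :> R.
Proof.
have jR : 1 <= j%:R :> R by rewrite ler1n.
have r2 : 0 <= (r%:R / 3 : R) <= 2 / 3.
  by rewrite divr_ge0//= ler_pM2r// ler_nat; lia.
apply: (@xgetPex R 0 [set g : R | 0 <= g /\ omega0 r j g = 0]%classic).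
have j0 : 0 <= j%:R + 1 :> R by lra.
have cw : {within `[0, (j%:R + 1)%R], continuous (omega0 r j : R -> R)}%classic.
  apply: continuous_in_subspaceT => t; rewrite inE/= in_itv/= => /andP[t0 _].
  have [dft _] := is_derive_omega0 t0.
  exact/differentiable_continuous/derivable1_diffP.
have b0 := asin_damp_bound (lexx 0); have b1 := asin_damp_bound j0.
have [|g gi g0] := IVT j0 cw (v := 0).
  move: b0 b1; rewrite !omega0_damp !ler_norml => /andP[? ?] /andP[? ?].
  by rewrite ge_min le_max; apply/andP; split; apply/orP; [left|right]; lra.
by exists g; split => //; move: gi; rewrite in_itv/= => /andP[].
Qed.

Let g : R := phi r j.
Let u := damp g.
Let V := damp_tan g.
Let w := Num.sqrt (1 - u ^+ 2).
Let delta := g - j%:R + 2^-1 - r%:R / 3.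

Lemma phi_delta : `|delta| <= 1 / 6.
Proof.
have [g0 gE] := phiP; have := asin_damp_bound g0; move: gE;
  rewrite omega0_damp -/delta => e.
by rewrite (_ : delta = - (s / pi * asin (damp (phi r j)))) ?normrN//; lra.
Qed.

(** The equation for phi says that pi delta = - s asin u. *)
Lemma sin_cos_delta : sin (pi * delta) = - (s * u) /\ cos (pi * delta) = w.
Proof.
have [g0 gE] := phiP; have pi0 := @pi_gt0 R.
have ui : -1 <= u <= 1 by have := damp_gt0 g; have := damp_le g0; rewrite -/g -/u;
  lra.
have e : pi * delta = - (s * asin u).
  have -> : delta = - (s / pi * asin u) by move: gE; rewrite omega0_damp -/delta -/u;
    lra.
  by move: (lt0r_neq0 pi0); move: (pi : R) => p p0; field.
have sa : sin (asin u) = u by rewrite asinK// in_itv.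
have ca : cos (asin u) = w by rewrite cos_asin.
by rewrite e sinN cosN /s; have [->|->] := sign_cases R (r + j);
  rewrite ?mul1r ?mulN1r ?sinN ?cosN sa ca.
Qed.

Lemma phi_bound : j%:R - 2 / 3 + r%:R / 3 <= g <= j%:R - 1 / 3 + r%:R / 3.
Proof. by have := phi_delta; rewrite /delta ler_norml; lra. Qed.

Lemma sqrt_damp y : 0 <= y ->
  Num.sqrt (1 - damp y ^+ 2) ^+ 2 = 1 - damp y ^+ 2 /\ 0 < Num.sqrt (1 - damp y ^+ 2).
Proof. by move=> y0; rewrite sqr_sqrtr ?sqrtr_gt0 ?ltW ?damp_cos_gt0. Qed.

Lemma is_derive_damp_tan y : 0 <= y ->
  is_derive y 1 damp_tan (- (s3 * pi) * (damp_tan y * (1 + damp_tan y ^+ 2))).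
Proof.
move=> y0; have [w2 w0] := sqrt_damp y0.
have d1 := is_derive_damp y.
have d2 : is_derive y 1 (fun z => 1 - damp z ^+ 2) (2 * (s3 * pi) * damp y ^+ 2).
  eapply is_derive_to.
    exact: is_derive_fun_add (is_derive_fun_cst 1 y) (is_derive_fun_opp
      (is_derive_fun_exp 2 d1)).
  by rewrite /=; ring.
have d3 := @is_derive_fun_comp _ _ (fun z =>
  1 - damp z ^+ 2) _ _ _ (is_derive1_sqrt (damp_cos_gt0 y0)) d2.
have d4 := is_derive_fun_mul d1 (@is_derive_fun_inv _ (fun z =>
  Num.sqrt (1 - damp z ^+ 2)) _ _ (lt0r_neq0 w0) d3).
eapply is_derive_to; first exact: d4.
rewrite /damp_tan; set W := Num.sqrt _ in w2 w0 *.
have WN0 : W != 0 by rewrite lt0r_neq0.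
have u2 : damp y ^+ 2 = 1 - W ^+ 2 by rewrite w2; ring.
by field: u2.
Qed.

Lemma damp_tan_powR y : 0 <= y ->
  (4 * expR (2 * s3 * pi * y) - 1) `^ (1 / 2) = (damp_tan y)^-1 /\
  (4 * expR (2 * s3 * pi * y) - 1) `^ (3 / 2) = (damp_tan y)^-1 ^+ 3.
Proof.
move=> y0; have [w2 w0] := sqrt_damp y0.
have d0 := damp_gt0 y.
have V0 : 0 <= (damp_tan y)^-1 by rewrite invr_ge0 divr_ge0 ?ltW.
have e : 4 * expR (2 * s3 * pi * y) - 1 = (damp_tan y)^-1 ^+ 2.
  have E0 : expR (s3 * pi * y) != 0 by rewrite gt_eqF ?expR_gt0.
  have -> : expR (2 * s3 * pi * y) = expR (s3 * pi * y) ^+ 2.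
    by rewrite -expRM_natl; congr expR; ring.
  rewrite /damp_tan invf_div expr_div_n w2 /damp expRN.
  by field.
have h1 : (4 * expR (2 * s3 * pi * y) - 1) `^ (1 / 2) = (damp_tan y)^-1.
  by rewrite e mul1r powR12_sqrt ?sqr_ge0// sqrtr_sqr ger0_norm.
split=> //; have -> : 3 / 2 = 1 / 2 * 3%:R :> R by ring.
by rewrite powRrM h1 powR_mulrn.
Qed.

Lemma omega1_damp y : 0 <= y -> omega1 r j y = 2 * s * pi * y ^+ 2 * damp_tan y.
Proof. by move=> y0; rewrite /omega1 (damp_tan_powR y0).1 invrK. Qed.

Lemma omega2_damp y : 0 <= y -> omega2 r j y =
  - (2 * s3 / 3) * pi * y ^+ 2 + s *
  (2 * (- (pi * y ^+ 2) - 2 * s3 / 3 * pi ^+ 2 * y ^+ 3 +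
    pi ^+ 3 * y ^+ 4) * damp_tan y
   + 2 * pi ^+ 3 * y ^+ 4 * damp_tan y ^+ 3).
Proof.
move=> y0; have [e1 e2] := damp_tan_powR y0.
by rewrite /omega2 e1 e2 -exprVn !invrK.
Qed.

Hypothesis g_gt0 : 0 < g.

(** The closed forms hold on [0, +oo); positivity of [g] makes them hold in a neighbourhood, as
    differentiating them requires. *)
Let near_pos : \forall y \near g, 0 <= y.
Proof. by apply: filterS (lt_nbhsr g_gt0) => y /ltW. Qed.

Lemma derive1_omega0 y : 0 <= y -> derive1 (omega0 r j) y = 1 - s3 * (s * damp_tan y).
Proof. by move=> y0; have [_ <-] := is_derive_omega0 y0; rewrite derive1E. Qed.

Lemma derive2_omega0 : derive1n 2 (omega0 r j) g = 3 * s * pi * (V * (1 + V ^+ 2)).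
Proof.
have d : is_derive g 1 (fun y => 1 +
  (- (s3 * s)) * damp_tan y) (3 * s * pi * (V * (1 + V ^+ 2))).
  eapply is_derive_to.
    exact: is_derive_fun_add (is_derive_fun_cst 1 g)
      (is_derive_fun_mul (is_derive_fun_cst (- (s3 * s)) g) (is_derive_damp_tan (ltW
        g_gt0))).
  by rewrite /= -/V; ring: (sqr_s3 R).
have d' : is_derive g 1 (derive1 (omega0 r j)) (3 * s * pi * (V * (1 + V ^+ 2))).
  apply: near_eq_is_derive d.
  by apply: filterS near_pos => y y0; rewrite derive1_omega0//; ring.
by rewrite /= derive1E; case: d'.
Qed.

Lemma derive1_omega1 : derive1 (omega1 r j) g =
  2 * s * pi * (2 * g * V - s3 * pi * g ^+ 2 * (V * (1 + V ^+ 2))).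
Proof.
have d : is_derive g 1 (fun y => 2 * s * pi * y ^+ 2 * damp_tan y)
    (2 * s * pi * (2 * g * V - s3 * pi * g ^+ 2 * (V * (1 + V ^+ 2)))).
  eapply is_derive_to.
    exact: is_derive_fun_mul (is_derive_fun_mul (is_derive_fun_cst (2 * s * pi) g)
      (is_derive_fun_exp 2 (is_derive_fun_id g))) (is_derive_damp_tan (ltW g_gt0)).
  by rewrite /= -/V; ring.
have d' : is_derive g 1 (omega1 r j) (2 * s * pi * (2 * g * V -
  s3 * pi * g ^+ 2 * (V * (1 + V ^+ 2)))).
  apply: near_eq_is_derive d.
  by apply: filterS near_pos => y y0; rewrite omega1_damp.
by rewrite derive1E; case: d'.
Qed.

End Root.
End Phase.

(** * The approximation regime *)

Section PhiBounds.
Variable R : realType.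
Local Notation s3 := (Num.sqrt 3 : R).
Variables r j : nat.
Hypothesis r3 : (r < 3)%N.
Hypothesis j1 : (0 < j)%N.
Let s : R := (-1) ^+ (r + j).
Let g : R := phi r j.
Let u := damp g.
Let V := damp_tan g.
Let w := Num.sqrt (1 - u ^+ 2).
Let J : R := j%:R.

Lemma phi_itv : J / 3 <= g <= 2 * J.
Proof.
have /andP[g1 g2] := @phi_bound R r j r3 j1.
have J1 : 1 <= J by rewrite /J ler1n.
have r0 : 0 <= r%:R :> R by [].
have r2 : r%:R <= 2 :> R by rewrite ler_nat; lia.
by rewrite /g /J in g1 g2 *; apply/andP; split; lra.
Qed.

Lemma phi_gt0 : 0 < g.
Proof.
have /andP[g1 _] := phi_itv; have J1 : 1 <= J by rewrite /J ler1n.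
by lra.
Qed.

(** From sqrt 3 pi >= 3 and phi >= j / 3; it yields the decay u <= e^-j. *)
Lemma phase_ge : J <= s3 * pi * g.
Proof.
have /andP[g1 g2] := phi_itv; have /andP[a b] := s3_bound R; have p2 := @pi_ge2 R.
have J1 : 1 <= J by rewrite /J ler1n.
have sp : 3 <= s3 * pi by nra.
by nra.
Qed.

Lemma damp_phi_le_exp : u <= expR (- J).
Proof.
have e : expR (- (s3 * pi * g)) <= expR (- J) by rewrite ler_expR lerN2 phase_ge.
by rewrite /u /damp; have := expR_gt0 (- J); lra.
Qed.

Lemma damp_phi_le : u <= 4^-1.
Proof.
have J1 : 1 <= J by rewrite /J ler1n.
have e : expR (- (s3 * pi * g)) <= 2^-1.
  rewrite expRN lef_pV2 ?posrE ?expR_gt0// (le_trans _ (expR_ge1Dx _))//.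
  by have := phase_ge; lra.
by rewrite /u /damp; lra.
Qed.

Lemma cos_delta_bound : w ^+ 2 = 1 - u ^+ 2 /\ 9 / 10 <= w <= 1.
Proof.
have [e w0] := sqrt_damp (ltW phi_gt0); rewrite -/g -/u -/w in e w0.
have u0 : 0 < u := damp_gt0 g; have u4 := damp_phi_le.
by split=> //; apply/andP; split; nra.
Qed.

Lemma damp_tan_bound : 0 <= V <= 1 / 2.
Proof.
have u0 : 0 < u := damp_gt0 g; have u4 := damp_phi_le.
have [_ /andP[w1 w2]] := cos_delta_bound.
have w0 : 0 < w by lra.
rewrite /V /damp_tan -/u -/w; apply/andP; split; first by rewrite divr_ge0 ?ltW.
by rewrite ler_pdivrMr//; lra.
Qed.

Lemma damp_tan_mul : w * V = u.
Proof.
have [_ /andP[w1 _]] := cos_delta_bound.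
by rewrite /V /damp_tan -/u -/w mulrCA divff ?mulr1//; lra.
Qed.

(** This is the coefficient of pi eta in the expansion: w >= 9/10, while sqrt 3 u <= 1/2 because u
    <= 1/4. *)
Lemma slope_bound : 2 / 5 <= w - s3 * (s * u).
Proof.
have u0 : 0 < u := damp_gt0 g; have u4 := damp_phi_le.
have [_ /andP[w1 _]] := cos_delta_bound; have /andP[a b] := s3_bound R.
have su : s3 * u <= 1 / 2 by nra.
have su0 : 0 <= s3 * u by nra.
by rewrite mulrCA /s; have [->|->] := sign_cases R (r + j); lra.
Qed.

Lemma slope_factor : w - s3 * (s * u) = w * (1 - s3 * (s * V)).
Proof. by rewrite -damp_tan_mul; ring. Qed.

Let D_neq0 : 1 - s3 * (s * V) != 0.
Proof.
have := slope_bound; rewrite slope_factor; apply: contraTneq => ->.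
by rewrite mulr0 -ltNge.
Qed.

Lemma psi_eq : psi r j * (1 - s3 * (s * V)) = - (2 * s * pi * g ^+ 2 * V).
Proof.
have g0 := ltW phi_gt0.
rewrite /psi derive1_omega0// omega1_damp// -/g -/s -/V mulNr divfK//.
Qed.

Lemma tau_eq : tau r j * (1 - s3 * (s * V)) =
  - (3 * s * pi * (V * (1 + V ^+ 2)) / 2 * psi r j ^+ 2
   + 2 * s * pi * (2 * g * V - s3 * pi * g ^+ 2 * (V * (1 + V ^+ 2))) * psi r j
   + (- (2 * s3 / 3) * pi * g ^+ 2 + s *
      (2 * (- (pi * g ^+ 2) - 2 * s3 / 3 * pi ^+ 2 * g ^+ 3 + pi ^+ 3 * g ^+ 4) * V
       + 2 * pi ^+ 3 * g ^+ 4 * V ^+ 3))).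
Proof.
have g0 := phi_gt0.
rewrite /tau derive2_omega0// derive1_omega1// derive1_omega0 ?(ltW g0)//.
rewrite omega2_damp ?(ltW g0)// -/g -/s -/V.
by rewrite mulNr mulNr mul1r mulrAC mulVf ?mul1r.
Qed.

Lemma order1_eq : w * (pi * psi r j) +
  s * u * (- (s3 * pi) * psi r j + 2 * pi ^+ 2 * g ^+ 2) = 0.
Proof.
rewrite -damp_tan_mul.
have -> : w * (pi * psi r j) + s * (w * V) * (- (s3 * pi) * psi r j +
  2 * pi ^+ 2 * g ^+ 2)
  = w * pi * (psi r j * (1 - s3 * (s * V)) + 2 * s * pi * g ^+ 2 * V) by ring.
by rewrite psi_eq addNr mulr0.
Qed.

Lemma order2_eq : let z1 := - (s3 * pi) * psi r j + 2 * pi ^+ 2 * g ^+ 2 in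
  let z2 := - (s3 * pi) * tau r j + 4 * pi ^+ 2 * (g * psi r j)
    - 4 * s3 / 3 * pi ^+ 3 * g ^+ 3 in
  w * (pi * tau r j - 2 * s3 / 3 * pi ^+ 2 * g ^+ 2)
  + s * u * (z2 + z1 ^+ 2 / 2 - 2 * pi ^+ 2 * g ^+ 2 +
    pi ^+ 2 * psi r j ^+ 2 / 2) = 0.
Proof.
move=> z1 z2; have s2 : s ^+ 2 = 1 by rewrite sqrr_sign.
(* Squared, this form of [psi_eq] gives the quadratic relation that closes the computation. *)
have psi2 : psi r j = s * V * (s3 * psi r j - 2 * pi * g ^+ 2).
  by have := psi_eq; lra.
have -> : w * (pi * tau r j - 2 * s3 / 3 * pi ^+ 2 * g ^+ 2)
  + s * u * (z2 + z1 ^+ 2 / 2 - 2 * pi ^+ 2 * g ^+ 2 + pi ^+ 2 * psi r j ^+ 2 / 2) =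
  w * (pi * (tau r j * (1 - s3 * (s * V))) - 2 * s3 / 3 * pi ^+ 2 * g ^+ 2
  + s * V * (4 * pi ^+ 2 * (g * psi r j) - 4 * s3 / 3 * pi ^+ 3 * g ^+ 3
   + z1 ^+ 2 / 2 - 2 * pi ^+ 2 * g ^+ 2 + pi ^+ 2 * psi r j ^+ 2 / 2)).
  by rewrite /z2 -damp_tan_mul; ring.
rewrite tau_eq /z1.
have psi_sqr : psi r j ^+ 2 = V ^+ 2 * (s3 * psi r j - 2 * pi * g ^+ 2) ^+ 2.
  by rewrite {1}psi2 !exprMn s2 mul1r.
apply/eqP; rewrite mulf_eq0; apply/orP; right; apply/eqP.
set p := psi r j in psi_sqr *.
have -> : V ^+ 3 = V * V ^+ 2 by rewrite exprS.
(* Once tau is eliminated, what is left is a multiple of the relation [psi_sqr]. *)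
have -> : pi * - (3 * s * pi * (V * (1 + V ^+ 2)) / 2 * p ^+ 2 +
      2 * s * pi * (2 * g * V - s3 * pi * g ^+ 2 * (V * (1 + V ^+ 2))) * p +
      (- (2 * s3 / 3) * pi * g ^+ 2 +
       s * (2 * (- (pi * g ^+ 2) - 2 * s3 / 3 * pi ^+ 2 * g ^+ 3 +
         pi ^+ 3 * g ^+ 4) * V +
        2 * pi ^+ 3 * g ^+ 4 * (V * V ^+ 2)))) - 2 * s3 / 3 * pi ^+ 2 * g ^+ 2 +
   s * V * (4 * pi ^+ 2 * (g * p) - 4 * s3 / 3 * pi ^+ 3 * g ^+ 3 +
    (- (s3 * pi) * p + 2 * pi ^+ 2 * g ^+ 2) ^+ 2 / 2 - 2 * pi ^+ 2 * g ^+ 2 +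
    pi ^+ 2 * p ^+ 2 / 2) =
   s * V * pi ^+ 2 / 2 * (p ^+ 2 - V ^+ 2 * (s3 * p - 2 * pi * g ^+ 2) ^+ 2).
  move: (pi : R) => P.
  by field: (sqr_s3 R).
by rewrite -psi_sqr subrr mulr0.
Qed.

End PhiBounds.

(** * Estimates for large n, uniform in j up to log n *)

Section Asymptotics.
Variable R : realType.
Local Notation s3 := (Num.sqrt 3 : R).

Lemma exprn_le_fact_expR (x : R) k : 0 <= x -> x ^+ k.+1 <= k.+1`!%:R * expR x.
Proof.
move=> x0; have := expR_ge1Dxn k x0 => H.
rewrite mulrC -ler_pdivrMr ?ltr0n ?fact_gt0// (le_trans _ H)// lerDr//.
Qed.

(* The perturbation [rg_eta] is part of the regime so that the constants of all
   estimates are independent of it: its final value [K j^3 h^3] involves one of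
   these constants. *)
Record regime := Regime {
  rg_n : nat; rg_j : nat; rg_eta : R;
  rg_j_gt0 : (0 < rg_j)%N;
  rg_j_le : rg_j%:R <= ln (rg_n%:R : R);
  rg_eta_le : `|rg_eta| <= (rg_n.+2%:R^-1) ^+ 2 }.

Definition regime_filter : set_system regime :=
  fun A => exists n0, forall t, (n0 <= rg_n t)%N -> A t.

#[export] Instance regime_filter_filter : Filter regime_filter.
Proof.
split; first by exists 0%N.
- move=> A B [n1 HA] [n2 HB]; exists (maxn n1 n2) => t.
  by rewrite geq_max => /andP[/HA ? /HB ?].
- by move=> A B AB [n0 HA]; exists n0 => t /HA /AB.
Qed.

Let J t : R := (rg_j t)%:R.
Let h t : R := (rg_n t).+2%:R^-1.
Let r t := (rg_n t %% 3)%N.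
Let g t : R := phi (r t) (rg_j t).
Let ps t : R := psi (r t) (rg_j t).
Let ta t : R := tau (r t) (rg_j t).
Let u t := damp (g t).
Let V t := damp_tan (g t).
Let w t := Num.sqrt (1 - u t ^+ 2).
Let s t : R := (-1) ^+ (r t + rg_j t).
Let eta t := rg_eta t.
Local Notation O := (bigo regime_filter J h).

Lemma rg_r_lt3 t : (r t < 3)%N.
Proof. by rewrite ltn_mod. Qed.

Lemma rg_J_ge1 t : 1 <= J t.
Proof. by rewrite ler1n rg_j_gt0. Qed.

Lemma rg_h_gt0 t : 0 < h t.
Proof. by rewrite invr_gt0. Qed.

(** From e^J <= n, J^(2k) h is at most M = (2k + 1)!, so the square of J^k h is at most M h, which
    tends to 0. *)
Lemma rg_small k e : 0 < e -> \forall t \near regime_filter, J t ^+ k * h t <= e.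
Proof.
move=> e0; pose M : R := ((2 * k).+1)`!%:R.
have M0 : 0 < M by rewrite ltr0n fact_gt0.
have Me : 0 <= M / e ^+ 2 by rewrite divr_ge0 ?sqr_ge0 ?ltW.
exists (Num.bound (M / e ^+ 2)) => t nt; have h0 := rg_h_gt0 t.
have J1 := rg_J_ge1 t; have J0 : 0 <= J t by lra.
have hM : M * h t <= e ^+ 2.
  rewrite ler_pdivrMr// mulrC -ler_pdivrMr ?exprn_gt0//
    (le_trans (ltW (archi_boundP Me)))//.
  by rewrite ler_nat; lia.
have n0 : (0 < rg_n t)%N.
  rewrite lt0n; apply: contraTneq (rg_j_le t) => ->.
  by rewrite ln0// -ltNge; have := rg_J_ge1 t; rewrite /J; lra.
have eJ : expR (J t) <= (rg_n t).+2%:R.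
  have : expR (J t) <= (rg_n t)%:R.
    by rewrite -[leRHS]lnK ?posrE ?ltr0n// ler_expR rg_j_le.
  by move=> /le_trans; apply; rewrite ler_nat; lia.
have J2k : J t ^+ (2 * k) * h t <= M.
  rewrite ler_pdivrMr// (le_trans (_ : _ <= J t ^+ (2 * k).+1))//.
    by rewrite exprS ler_peMl// exprn_ge0.
  rewrite (le_trans (exprn_le_fact_expR _ J0))// ler_pM2l//.
rewrite -(@ler_pXn2r _ 2)// ?nnegrE ?(ltW e0)// ?mulr_ge0 ?exprn_ge0 ?(ltW h0)//.
rewrite (le_trans _ hM)// exprMn expr2 [h t ^+ 2]expr2 -exprD addnn -mul2n mulrA.
by rewrite ler_pM2r.
Qed.

Let J_ge1 := rg_J_ge1.
Let h_gt0 := rg_h_gt0.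
Let Jh_small := rg_small.

Let h_O : O 0 1 h.
Proof. exact: bigo_h. Qed.

Let g_O : O 1 0 g.
Proof.
exists 2; apply: filterE => t; rewrite expr0 mulr1 expr1.
have /andP[g1 g2] := @phi_itv R _ _ (rg_r_lt3 t) (rg_j_gt0 t).
rewrite ger0_norm//; have := rg_J_ge1 t; rewrite /J => ?.
by rewrite (le_trans _ g1)//; lra.
Qed.

Let s_O : O 0 0 s.
Proof. by exists 1; apply: filterE => t; rewrite !expr0 !mulr1 normr_sign. Qed.

Let w_O : O 0 0 w.
Proof.
exists 1; apply: filterE => t; rewrite !expr0 !mulr1.
have [_ /andP[w1 w2]] := @cos_delta_bound R _ _ (rg_r_lt3 t) (rg_j_gt0 t).
by rewrite ger0_norm// sqrtr_ge0.
Qed.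

Let V_O : O 0 0 V.
Proof.
exists 1; apply: filterE => t; rewrite !expr0 !mulr1.
have /andP[w1 w2] := @damp_tan_bound R _ _ (rg_r_lt3 t) (rg_j_gt0 t).
by rewrite ger0_norm// (le_trans w2)//; lra.
Qed.

Let eta_O : O 0 2 eta.
Proof. by exists 1; apply: filterE => t; rewrite expr0 !mul1r rg_eta_le. Qed.

(** Since u <= e^-J, the product u J^a is at most (a + 1)!. *)
Let u_O : forall a b f, O a b f -> O 0 b (fun t => u t * f t).
Proof.
move=> a b f /bigo_pos[//|//|C C0 HC]; exists (C * (a.+1)`!%:R).
apply: filterS HC => t Ct; have u0 : 0 < u t := damp_gt0 _.
have J1 := rg_J_ge1 t; have J0 : 0 <= J t by lra.
have uJ : u t * J t ^+ a <= a.+1`!%:R.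
  have uE := @damp_phi_le_exp R _ _ (rg_r_lt3 t) (rg_j_gt0 t).
  have Ja : J t ^+ a <= a.+1`!%:R * expR (J t).
    by rewrite (le_trans _ (exprn_le_fact_expR _ J0))// exprS ler_peMl// exprn_ge0.
  rewrite (le_trans (ler_pM (ltW u0) _ uE Ja)) ?exprn_ge0// mulrCA.
  by rewrite mulrC [expR _ * _]mulrC expRxMexpNx_1 mul1r.
rewrite normrM gtr0_norm// expr0 mul1r.
rewrite (le_trans (ler_wpM2l (ltW u0) Ct))//.
have -> : u t * (C * (J t ^+ a * h t ^+ b)) = C * (u t * J t ^+ a) * h t ^+ b by ring.
by rewrite ler_wpM2r ?exprn_ge0 ?(ltW (h_gt0 t))// ler_wpM2l// ltW.
Qed.

Let slope t := w t - s3 * (s t * u t).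

Let slope_ge t : 2 / 5 <= slope t.
Proof. exact: (@slope_bound R _ _ (rg_r_lt3 t) (rg_j_gt0 t)). Qed.

Let uE t : u t = w t * V t.
Proof. by rewrite [RHS](@damp_tan_mul R _ _ (rg_r_lt3 t) (rg_j_gt0 t)). Qed.

Let bigo_slope : forall a b f k,
  O a b k -> (forall t, f t * slope t = k t) -> O a b f.
Proof.
move=> a b f k kO fk; have k2 : O a b (fun t =>
  5 / 2 * k t) by exact: (bigo_mul (bigo_cst J h (5 / 2)) kO).
apply: bigo_le k2; apply: filterE => t; rewrite -fk !normrM.
rewrite (gtr0_norm (_ : 0 < 2^-1))// (gtr0_norm (_ : 0 < 5))//.
have sl := slope_ge t; have sl0 : 0 <= slope t by lra.
rewrite (ger0_norm sl0).
by have := normr_ge0 (f t); nra.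
Qed.

(** As w V = u, the factor V of psi turns into u, which absorbs the growth of g^2. *)
Let psi_O : O 0 0 ps.
Proof.
have q_O : O 2 0 (fun t => - (2 * s t * pi * g t ^+ 2)) by bigo_tac.
apply: (bigo_slope (u_O q_O)) => t.
rewrite /slope slope_factor ?rg_j_gt0 ?rg_r_lt3// mulrCA psi_eq ?rg_j_gt0 ?rg_r_lt3//.
by rewrite uE -/(g t) -/(V t) -/(s t) -/(u t) -/(w t); ring.
Qed.

Let tau_O : O 2 0 ta.
Proof.
pose q t := - (3 * s t * pi * (1 + V t ^+ 2) / 2 * ps t ^+ 2
   + 2 * s t * pi * (2 * g t - s3 * pi * g t ^+ 2 * (1 + V t ^+ 2)) * ps t
   + s t * (2 * (- (pi * g t ^+ 2) -
     2 * s3 / 3 * pi ^+ 2 * g t ^+ 3 + pi ^+ 3 * g t ^+ 4)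
       + 2 * pi ^+ 3 * g t ^+ 4 * V t ^+ 2)).
have q_O : O 4 0 q by rewrite /q; bigo_tac.
have uq_O := u_O q_O.
pose uq t := u t * q t; change (O 0 0 uq) in uq_O.
(* The one term of tau without a factor V, of size g^2, accounts for the power J^2. *)
have k_O : O 2 0 (fun t => w t * (2 * s3 / 3 * pi * g t ^+ 2) + uq t) by bigo_tac.
apply: (bigo_slope k_O) => t.
rewrite /slope slope_factor ?rg_j_gt0 ?rg_r_lt3// mulrCA tau_eq ?rg_j_gt0 ?rg_r_lt3//.
rewrite /uq /q uE -/(g t) -/(V t) -/(s t) -/(u t) -/(w t) -/(ps t).
by move: (w t) (V t) (s t) (g t) (ps t) (pi : R) => a b c d e p; field.
Qed.

Definition gamma t : R := g t + (ps t * h t + ta t * h t ^+ 2 + eta t).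

Let eps_O : O 0 1 (fun t => ps t * h t + ta t * h t ^+ 2 + eta t).
Proof. by bigo_tac. Qed.

Definition phase_fun t (gam : R) :=
  let x := pi * gam * h t in
  let delta := gam - (rg_j t)%:R + 2^-1 - (r t)%:R / 3 in
  let tt := (1 - cos (2 * x)) / (s3 + sin (2 * x)) in
  sin (pi * delta) - tt * cos (pi * delta)
  + s t / 2 * (1 - s3 * tt) / (cos x + s3 * sin x) ^+ (rg_n t).+2.

Lemma phase_expansion : exists2 C : R, 0 < C & exists n0, forall t,
  (n0 <= rg_n t)%N ->
  `|phase_fun t (gamma t) - pi * slope t * eta t| <= C * (J t ^+ 3 * h t ^+ 3).
Proof.
pose delta t : R := g t - (rg_j t)%:R + 2^-1 - (r t)%:R / 3.
have Nh t : (rg_n t).+2%:R * h t = 1 by rewrite divff// pnatr_eq0.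
have uexp t : u t = expR (- (s3 * pi * g t)) / 2 by rewrite /u /damp mulrC.
have o1 t := @order1_eq R _ _ (rg_r_lt3 t) (rg_j_gt0 t).
have o2 t := @order2_eq R _ _ (rg_r_lt3 t) (rg_j_gt0 t).
have sd t := (@sin_cos_delta R _ _ (rg_r_lt3 t) (rg_j_gt0 t)).1.
have cd t := (@sin_cos_delta R _ _ (rg_r_lt3 t) (rg_j_gt0 t)).2.
have := @secular_expansion R regime _ regime_filter_filter J h J_ge1 h_gt0 Jh_small _
  g ps ta eta u w s
  Nh g_O psi_O tau_O eta_O w_O s_O u_O uexp o1 o2 delta sd cd.
move=> /bigo_pos[//|//|C C0 [n0 HC]]; exists C => //; exists n0 => t /HC.
congr (`|_ - _| <= _); rewrite /phase_fun -/(gamma t).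
have -> // : gamma t - (rg_j t)%:R + 2^-1 - (r t)%:R / 3 =
  delta t + (ps t * h t + ta t * h t ^+ 2 + eta t) by rewrite /gamma /delta; ring.
Qed.

(** After scaling by n + 2, phi stays at least 1/6 away from both ends of its bracket, and the
    correction is eventually at most 1/10. *)
Lemma gamma_bracket : exists n0, forall t,
  (n0 <= rg_n t)%N -> (rg_j t <= rg_n t %/ 3)%N /\
  bracket R (rg_n t) (rg_j t).-1 < gamma t * h t < bracket R (rg_n t) (rg_j t).
Proof.
have e10 : 0 < 1 / 10 :> R by lra.
have e6 : 0 < 1 / 6 :> R by lra.
have [n1 H1] := bigo_small J_ge1 h_gt0 Jh_small eps_O e10.
have [n2 H2] := Jh_small 1 e6.
exists (maxn 6 (maxn n1 n2)) => t; rewrite !geq_max => /and3P[n6 /H1 eb /H2 Jb].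
have j1 := rg_j_gt0 t; have r3 := rg_r_lt3 t.
split.
  move: Jb; rewrite expr1 ler_pdivrMr// => Jb.
  have : (6 * rg_j t)%:R <= (rg_n t).+2%:R :> R by rewrite natrM; move: Jb;
    rewrite /J; lra.
  by rewrite ler_nat; lia.
have /andP[g1 g2] := @phi_bound R _ _ r3 j1.
rewrite /bracket !ltr_pM2r ?invr_gt0// -/(r t).
move: eb; rewrite ler_norml /gamma => /andP[e1 e2].
have -> : (rg_j t).-1%:R = (rg_j t)%:R - 1 :> R by rewrite -subn1 natrB.
by rewrite -/(g t) in g1 g2; apply/andP; split; lra.
Qed.

End Asymptotics.

(** * Change of sign around the approximation *)

Lemma secular_alpha_phase (R : realType) (t : regime R) :
  let a := gamma t * (rg_n t).+2%:R^-1 in 0 <= a <= 1 / 3 ->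
  exists2 k : R, 0 < k & secular_alpha (rg_n t) a =
    (-1) ^+ (rg_n t %/ 3 + rg_j t) * k * phase_fun t (gamma t).
Proof.
move=> a ai; have /andP[c1 _] := cos_theta_itv ai.
set x := pi * gamma t * (rg_n t).+2%:R^-1.
have cE : 2 * cos (pi / 3 - pi * a) = cos x + Num.sqrt 3 * sin x.
  by rewrite -two_cos_theta /a /x mulrA.
rewrite cE in c1.
have c0 : cos x + Num.sqrt 3 * sin x != 0 by rewrite gt_eqF// (lt_le_trans ltr01).
have den0 : 0 < Num.sqrt 3 + sin (2 * x).
  by have := sin_geN1 (2 * x); have /andP[] := s3_bound R; lra.
(* This factor is positive, so the remaining sign depends on n and j but not on the perturbation. *)
exists ((cos x + Num.sqrt 3 * sin x) ^+ (rg_n t).+1 * (Num.sqrt 3 + sin (2 * x))).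
  by rewrite mulr_gt0// exprn_gt0// (lt_le_trans ltr01).
rewrite /a (@secular_phase _ _ (rg_j t))// -/x /phase_fun -/x.
by congr (_ * _); rewrite mulrAC [RHS]mulrC.
Qed.

Theorem theorem1p5 (R : realType) :
  exists C2 : R, 0 < C2 /\
  exists N : nat, forall n : nat, (N <= n)%N ->
  forall j : nat, (1 <= j)%N -> j%:Z <= Num.floor (ln (n%:R : R)) ->
  let r := (n %% 3)%N in
  let alpha : R :=
    phi r j / (n%:R + 2) + psi r j / (n%:R + 2) ^+ 2
    + tau r j / (n%:R + 2) ^+ 3 in
  0 <= alpha <= 1 / 3 /\
  exists R2 : R,
    lambda n j = G alpha + R2 /\
    `|R2| <= C2 * j%:R ^+ 3 / (n%:R + 2) ^+ 4.
Proof.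
have [C C0 [n1 H1]] := phase_expansion R.
have [n2 H2] := gamma_bracket R.
(* With this K the error C j^3 h^3 is at most d / 2, while the slope term has modulus at least 4 d /
   5. *)
pose K : R := 2 * (C + 1); have K0 : 0 < K by rewrite /K; lra.
have K1 : 0 < K^-1 by rewrite invr_gt0.
(* Ensures K j^3 h^3 <= h^2, so that d and - d are admissible perturbations. *)
have [n3 H3] := @rg_small R 3 _ K1.
exists (288 * K); split; first by rewrite mulr_gt0.
exists (maxn n1 (maxn n2 n3)) => n;
  rewrite !geq_max => /and3P[nn1 nn2 nn3] j j1 jn r alpha.
have jln : j%:R <= ln (n%:R : R) by move: jn; rewrite real_floor_ge_int ?num_real.
have nE : n%:R + 2 = n.+2%:R :> R by rewrite -(natrD _ n 2) addn2.
pose h : R := n.+2%:R^-1; have h0 : 0 < h by rewrite invr_gt0.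
have jR : 1 <= j%:R :> R by rewrite ler1n.
pose d : R := K * (j%:R ^+ 3 * h ^+ 3).
have j0 : 0 < j%:R :> R by lra.
have d0 : 0 < d by apply: mulr_gt0 => //; apply: mulr_gt0; exact: exprn_gt0.
have eta0 : `|0 : R| <= h ^+ 2 by rewrite normr0 sqr_ge0.
(* The zero perturbation gives [alpha] itself; [tp] and [tm] below shift it by d h to either
   side. *)
pose t0 := Regime j1 jln eta0.
have dh : d <= h ^+ 2.
  have := H3 t0 nn3; rewrite /= -/h -(ler_pM2l K0) divff ?gt_eqF// => le1.
  rewrite (_ : d = K * (j%:R ^+ 3 * h) * h ^+ 2); last by rewrite /d; ring.
  by rewrite ler_piMl ?sqr_ge0.
have etap : `|d| <= h ^+ 2 by rewrite gtr0_norm.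
have etam : `|- d| <= h ^+ 2 by rewrite normrN gtr0_norm.
pose tp := Regime j1 jln etap; pose tm := Regime j1 jln etam.
have gp : gamma tp = gamma t0 + d by rewrite /gamma/=; ring.
have gm : gamma tm = gamma t0 - d by rewrite /gamma/=; ring.
have alphaE : alpha = gamma t0 * h.
  by rewrite /alpha nE /gamma/= -/r -/h; rewrite -!exprVn -/h; ring.
have [jm b0] := H2 t0 nn2; have [_ bp] := H2 tp nn2; have [_ bm] := H2 tm nn2.
rewrite /= -/h in b0 bp bm jm.
have jm' : (j.-1 <= n %/ 3)%N := leq_trans (leq_pred _) jm.
have /andP[Bj1 _] := bracket_itv R jm'; have /andP[_ Bj2] := bracket_itv R jm.
have itv t : bracket R n j.-1 < t < bracket R n j -> 0 <= t <= 1 / 3 by lra.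
have K2 : C * (j%:R ^+ 3 * h ^+ 3) <= d / 2.
  have y0 : 0 <= j%:R ^+ 3 * h ^+ 3 by rewrite mulr_ge0 ?exprn_ge0 ?ltW.
  by rewrite /d /K; move: (_ * _) y0 => y y0; nra.
have p2 := @pi_ge2 R.
have sp : 0 <= phase_fun tp (gamma tp).
  have := H1 tp nn1; rewrite /= -/h ler_norml => /andP[+ _].
  have := @slope_bound R r j (ltn_pmod _ _) j1.
  set sl := Num.sqrt _ - _ => /(_ isT) sl25.
  have : 4 / 5 <= pi * sl by nra.
  by nra.
have sm : phase_fun tm (gamma tm) <= 0.
  have := H1 tm nn1; rewrite /= -/h ler_norml => /andP[_ +].
  have := @slope_bound R r j (ltn_pmod _ _) j1.
  set sl := Num.sqrt _ - _ => /(_ isT) sl25.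
  have : 4 / 5 <= pi * sl by nra.
  by nra.
have [kp kp0 ep] := secular_alpha_phase (itv _ bp).
have [km km0 em] := secular_alpha_phase (itv _ bm).
rewrite /= -/h in ep em.
have le_mp : gamma tm * h <= gamma tp * h by rewrite ler_pM2r// gp gm; lra.
(* The zero found here is within d h of [alpha] and in the j-th bracket, so [G] maps it to the j-th
   eigenvalue. *)
have [|a /andP[a1 a2] sa] := IVT0 (@continuous_secular_alpha R n) le_mp.
  rewrite ep em; set sg := (-1) ^+ _;
    have sg2 : sg * sg = 1 by rewrite -expr2 sqrr_sign.
  rewrite mulrACA mulr_ge0_le0// ?mulr_le0_ge0//.
  by rewrite mulrACA sg2 mul1r mulr_ge0 ?ltW.
have ab : bracket R n j.-1 < a < bracket R n j by move: bp bm; lra.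
rewrite -alphaE in b0; split; first exact: itv.
exists (G a - G alpha); split.
  by rewrite (@lambda_root R n j a)// ?j1//; ring.
rewrite (le_trans (G_lip (itv _ ab) (itv _ b0)))// nE.
have : `|a - alpha| <= d * h.
  by move: a1 a2; rewrite alphaE gp gm; move: (gamma t0) (d) (h) => x y z ? ?;
    rewrite ler_norml; apply/andP; split; lra.
rewrite (_ : 288 * K * j%:R ^+ 3 / n.+2%:R ^+ 4 = 288 * (d * h)); first by move=> H;
  rewrite ler_pM2l.
by rewrite /d -exprVn -/h; ring.
Qed.
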